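(* Let $G$ be a locally compact group with $\kappa(G)>\aleph_0$ (i.e. $G$ is not $\sigma$-compact). Then $\mathrm{LIM}_0(G)=\mathrm{LIM}(G)$.
   Context: For $S\subset G$, $\kappa(S)$ is the smallest cardinality of a collection of compact subsets of $G$ whose union contains $S$. $|E|$ denotes the left Haar measure of $E\subset G$. $\mathcal L_\infty(G)$ is the usual space with respect to Haar measure, identified with the dual of $\mathcal L_1(G)$. The set of means is $\mathcal M(G)=\{\mu\in\mathcal L_\infty^*(G): \|\mu\|=1,\ \mu\ge 0\}$. Each $f\in\mathcal L_1(G)$ is regarded as an element of $\mathcal L_\infty^*(G)$ via $\phi\mapsto\int_G f\phi$. Write $l_x\phi(y)=\phi(x^{-1}y)$. The left-invariant means are $\mathrm{LIM}(G)=\{\mu\in\mathcal M(G):\mu(\phi)=\mu(l_x\phi)\ \text{for all } x\in G,\ \phi\in\mathcal L_\infty(G)\}$. For a compact set $A\subset G$ of positive measure, $\mu_A=\chi_A/|A|$. For $K\subset G$ and $\epsilon>0$, $\mathscr C^+(K,\epsilon)$ is the set of compact $A\subset G$ with $|A|>0$ and $|xA\triangle A|/|A|<\epsilon$ for all $x\in K$. For a mean $\mu$ write $\mu(E)=\mu(\chi_E)$. For a finite measurable partition $\mathcal P$ of $G$ and $\epsilon\in(0,1)$, $\mathcal N(\mu,\mathcal P,\epsilon)=\{\nu\in\mathcal M(G): |\mu(E)-\nu(E)|<\epsilon\ \text{for all } E\in\mathcal P\}$. Then $\mathrm{LIM}_0(G)$ is the set of $\mu\in\mathrm{LIM}(G)$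 such that for every finite measurable partition $\mathcal P$ of $G$, every finite $K\subset G$ and every $\epsilon\in(0,1)$ there is $A\in\mathscr C^+(K,\epsilon)$ with $\mu_A\in\mathcal N(\mu,\mathcal P,\epsilon)$. *)

(* Defs.v *)
From HB Require Import structures.
From mathcomp Require Import all_boot all_order all_algebra.
From mathcomp Require Import all_classical all_reals all_analysis.
From mathcomp Require Import measurable_realfun ess_sup_inf.

Set Implicit Arguments.
Unset Strict Implicit.
Unset Printing Implicit Defensive.
Import Order.TTheory GRing.Theory Num.Theory.
Import numFieldNormedType.Exports.

Local Open Scope classical_set_scope.
Local Open Scope ring_scope.
Local Open Scope measure_scope.

(* Locally compact groups are Hausdorff, as usual.  A distinguished point is
   carried along only because measurable types are pointed. *)
HB.mixin Record isLocallyCompactGroup G & PointedTopological G & Group G := {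
  mulg_continuous : continuous (fun z : G * G => (z.1 * z.2)%g) ;
  invg_continuous : continuous (fun x : G => x^-1%g) ;
  lcg_hausdorff : hausdorff_space G ;
  lcg_locally_compact : locally_compact [set: G] }.

#[short(type="lcGroupType")]
HB.structure Definition LocallyCompactGroup :=
  {G of PointedTopological G & Group G & isLocallyCompactGroup G}.

Section kappa.
Context {G : topologicalType}.

Definition compact_cover (S : set G) (C : set (set G)) :=
  (forall K, C K -> compact K) /\ S `<=` \bigcup_(K in C) K.

(* kappa(S) > aleph_0: kappa(S) is the least cardinality of a family C with
   [compact_cover S C], so it exceeds aleph_0 iff no such C is countable. *)
Definition kappa_gt_aleph0 (S : set G) :=
  forall C, compact_cover S C -> ~ (C #<= [set: nat])%card.

End kappa.

Section L1_Linfty.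
Context d (T : measurableType d) (R : realType) (m : {measure set T -> \bar R}).

Lemma indic_Linfty (E : set T) : measurable E ->
  (\1_E : T -> R) \in Lfun m +oo%E.
Proof.
move=> mE; rewrite inE; apply/andP; split; rewrite inE /=.
  exact: measurable_indic.
rewrite /finite_norm unlock; case: ifPn => // G0.
apply: (@le_lt_trans _ _ 1%E); last exact: ltry.
apply/ess_supP; apply: nearW => x /=.
by rewrite lee_fin indicE; case: (_ \in _); rewrite ?normr1// normr0.
Qed.

Lemma indic_L1 (E : set T) (c : R) : measurable E -> (m E < +oo)%E ->
  (fun x => \1_E x / c) \in Lfun m 1%E.
Proof.
move=> mE Efin; apply/Lfun1_integrable.
have iE : m.-integrable [set: T] (EFin \o (\1_E : T -> R)).
  apply/integrableP; split; first exact/measurable_EFinP/measurable_indic.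
  rewrite (eq_integral (fun x => (\1_E x)%:E)); last first.
    by move=> x _; rewrite /= ger0_norm.
  by rewrite integral_indic// setIT.
apply: eq_integrable (integrableZl measurableT c^-1 iE) => // x _ /=.
by rewrite -EFinM mulrC.
Qed.

Notation L1 := (LfunType m (lexx 1%E)).
Notation Linfty := (LfunType m (leey 1%E)).

Lemma integrable_L1_Linfty (f : L1) (phi : Linfty) :
  m.-integrable [set: T] (EFin \o (fun x => f x * phi x)).
Proof.
have fL1 := LfunP f; move/Lfun1_integrable : (fL1) => /integrableP[mf foo].
have mphi : measurable_fun setT phi by exact: measurable_funPT.
have mf' : measurable_fun setT f by exact: measurable_funPT.
apply/integrableP; split; first exact/measurable_EFinP/measurable_funM.
have [M phiM] : exists M : R, \forall x \ae m, (`|(phi x)%:E| <= M%:E)%E.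
  have := Lfunction_finite _ phi; rewrite /finite_norm unlock; case: ifPn => [_|G0].
    by move=> /(@ess_supr_bounded _ _ _ _ (Num.norm \o phi)) [M]; exists M.
  exists 0; exists [set: T]; split => //.
  by apply/eqP; rewrite eq_le measure_ge0 andbT leNgt.
apply: (@le_lt_trans _ _ (\int[m]_x (`|M|%:E * `|(f x)%:E|))%E); last first.
  rewrite ge0_integralZl//; first by rewrite lte_mul_pinfty.
  exact/measurableT_comp.
apply: ae_ge0_le_integral => //.
- by apply/measurableT_comp => //; exact/measurable_EFinP/measurable_funM.
- by apply: measurable_funeM; exact/measurableT_comp.
- apply: filterS phiM => x phixM _ /=; rewrite normrM lee_fin mulrC.
  by apply: ler_wpM2r => //; rewrite -lee_fin (le_trans phixM)// lee_fin ler_norm.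
Qed.

Definition L1_pairing (f : L1) (phi : Linfty) : R := \int[m]_x (f x * phi x).

Lemma L1_pairing_linear (f : L1) : scalar (L1_pairing f).
Proof.
move=> a phi psi; rewrite /L1_pairing.
transitivity (\int[m]_x (a * (f x * phi x) + f x * psi x)).
  by apply: eq_Rintegral => x _ /=; rewrite mulrDr mulrCA.
rewrite RintegralD ?RintegralZl//; try exact: integrable_L1_Linfty.
have := integrableZl measurableT a (integrable_L1_Linfty f phi).
by apply: eq_integrable.
Qed.

HB.instance Definition _ (f : L1) :=
  GRing.isLinear.Build R Linfty R *%R (L1_pairing f) (L1_pairing_linear f).

Definition L1_dual (f : L1) : {scalar Linfty} := L1_pairing f.

End L1_Linfty.

Definition ltrans (G : lcGroupType) (x : G) (A : set G) : set G :=
  [set (x * y)%g | y in A].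

Notation borel G := (g_sigma_algebraType (@open G)).

(* Haar measures are Radon measures on the Borel sets, in the convention that
   requires outer regularity of all Borel sets but inner regularity of open
   sets only. *)
Record haar_measure (R : realType) (G : lcGroupType) := HaarMeasure {
  haar_mu :> {measure set borel G -> \bar R} ;
  haar_compact : forall K : set G, compact K -> (haar_mu K < +oo)%E ;
  haar_outer : forall E : set (borel G), measurable E ->
    haar_mu E =
    ereal_inf [set haar_mu U | U in [set U : set G | open U /\ E `<=` U]] ;
  haar_inner : forall U : set G, open U ->
    haar_mu U =
    ereal_sup [set haar_mu K | K in [set K : set G | compact K /\ K `<=` U]] ;
  haar_left : forall (x : G) (E : set (borel G)), measurable E ->
    haar_mu (ltrans x E) = haar_mu E ;
  haar_neq0 : (0 < haar_mu [set: G])%E }.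

(* G with the sigma-algebra of Haar-measurable sets, i.e., the sets that are
   Caratheodory-measurable for the outer measure induced by mu; these are the
   sets that are locally measurable for the completion of mu. *)
Notation hmeas mu := (caratheodory_type (haar_mu mu)^*).

Section essential_haar.
Context (R : realType) (G : lcGroupType) (mu : haar_measure R G).

(* When G is not sigma-compact, the dual of L_1(G) is L_infty modulo *locally*
   null sets, i.e., sets E such that E `&` K is null for every compact K.
   These are the null sets of the measure [ess_haar] below, which agrees with
   mu on the sets of finite (or sigma-finite) measure. *)
Definition ess_haar (E : set (hmeas mu)) : \bar R :=
  ereal_sup [set (haar_mu mu)^* (E `&` K) | K in @compact G].

Lemma ess_haar0 : ess_haar set0 = 0%E.
Proof.
rewrite /ess_haar (_ : [set _ | _ in _] = [set 0%E]) ?ereal_sup1//.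
apply/seteqP; split => [_ [K _ <-]|_ ->] /=; first by rewrite set0I outer_measure0.
by exists set0; [exact: compact0|rewrite set0I outer_measure0].
Qed.

Lemma ess_haar_ge0 E : (0 <= ess_haar E)%E.
Proof.
apply: ereal_sup_ubound; exists set0; first exact: compact0.
by rewrite setI0 outer_measure0.
Qed.

Lemma ess_haar_sup E K : compact K -> ((haar_mu mu)^* (E `&` K) <= ess_haar E)%E.
Proof. by move=> cK; apply: ereal_sup_ubound; exists K. Qed.

Lemma ess_haar_le A B : A `<=` B -> (ess_haar A <= ess_haar B)%E.
Proof.
move=> AB; apply: ge_ereal_sup => _ [K cK <-].
by apply: le_trans (ess_haar_sup _ cK); apply: le_outer_measure; exact: setSI.
Qed.

Lemma haar_fin E K : compact K -> (haar_mu mu)^* (E `&` K) \is a fin_num.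
Proof.
move=> cK; rewrite ge0_fin_numE ?outer_measure_ge0//.
apply: (@le_lt_trans _ _ ((haar_mu mu)^* K)); first by apply: le_outer_measure; exact: subIsetr.
rewrite measurable_mu_extE ?haar_compact//.
rewrite -[K]setCK; apply: measurableC; apply: sub_sigma_algebra.
exact/closed_openC/(compact_closed lcg_hausdorff).
Qed.

Lemma ess_haar_superadd (A B : set (hmeas mu)) : measurable A -> measurable B ->
  A `&` B = set0 -> (ess_haar A + ess_haar B <= ess_haar (A `|` B))%E.
Proof.
move=> mA mB AB; set C := ess_haar (A `|` B).
have key K L : compact K -> compact L ->
    ((haar_mu mu)^* (A `&` K) + (haar_mu mu)^* (B `&` L) <= C)%E.
  move=> cK cL; apply: le_trans (ess_haar_sup _ (compactU cK cL)).
  rewrite [X in (_ <= _ X)%E]setIC disjoint_caratheodoryIU//; last exact/eqP.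
  apply: leeD; apply: le_outer_measure; rewrite setIC; apply: setSI.
    exact: subsetUl.
  exact: subsetUr.
have [Aoo|Afin] := eqVneq (ess_haar A) +oo%E; last first.
  have {}Afin : ess_haar A \is a fin_num.
    by rewrite ge0_fin_numE ?ess_haar_ge0// ltey.
  rewrite addeC -leeBrDr//; apply: ge_ereal_sup => _ [L cL <-].
  rewrite leeBrDr// addeC -leeBrDr ?haar_fin//.
  by apply: ge_ereal_sup => _ [K cK <-]; rewrite leeBrDr ?haar_fin// key.
have : (ess_haar A <= C)%E by exact/ess_haar_le/subsetUl.
by rewrite Aoo leye_eq => /eqP ->; rewrite leey.
Qed.

Lemma ess_haar_sigma_additive : semi_sigma_additive ess_haar.
Proof.
move=> F mF tF mUF.
have cvgF : cvgn (fun n => \sum_(0 <= i < n) ess_haar (F i))%E.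
  by apply: is_cvg_nneseries => n _ _; exact: ess_haar_ge0.
suff -> : ess_haar (\bigcup_n F n) = (\sum_(i <oo) ess_haar (F i))%E by [].
apply/eqP; rewrite eq_le; apply/andP; split.
  apply: ge_ereal_sup => _ [K cK <-]; rewrite setI_bigcupl.
  apply: le_trans (outer_measure_sigma_subadditive (haar_mu mu)^* _) _.
  apply: lee_nneseries => [n _ _|n _]; first exact: outer_measure_ge0.
  exact: ess_haar_sup.
apply: lime_le => //; apply: nearW => n.
apply: (@le_trans _ _ (ess_haar (\big[setU/set0]_(i < n) F i))); last first.
  exact/ess_haar_le/bigsetU_bigcup.
elim: n => [|n ih]; first by rewrite big_nil ess_haar_ge0.
rewrite big_nat_recr//= big_ord_recr/=.
apply: le_trans (ess_haar_superadd _ _ _) => //.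
- by rewrite leeD2r.
- exact: bigsetU_measurable.
- by apply: (@trivIset_bigsetUI _ predT) => //; rewrite /predT /= trueE.
Qed.

HB.instance Definition _ := isMeasure.Build _ (hmeas mu) R ess_haar
  ess_haar0 ess_haar_ge0 ess_haar_sigma_additive.

End essential_haar.
Arguments ess_haar {R G} mu E.

(* Elements of L_1(G) and L_infty(G) are real-valued functions, not classes of
   functions: a linear functional of finite norm on the seminormed space
   [Linfty mu] respects equality almost everywhere. *)
Notation L1 mu := (LfunType (ess_haar mu) (lexx 1%E)).
Notation Linfty mu := (LfunType (ess_haar mu) (leey 1%E)).

Section dual.
Context (R : realType) (G : lcGroupType) (mu : haar_measure R G).

Lemma ltransE x (A : set G) : ltrans x A = (fun y => (x^-1 * y)%g) @^-1` A.
Proof.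
apply/seteqP; split => [_ [y Ay <-]/=|y /= Ay]; first by rewrite mulKg.
by exists (x^-1 * y)%g => //; rewrite mulVKg.
Qed.

Lemma mulg_cts (x : G) : continuous (fun y : G => (x * y)%g).
Proof.
move=> y; apply: (@continuous_comp _ _ _ (fun y => (x, y)) (fun z => z.1 * z.2)%g).
  by apply: cvg_pair => //=; exact: cvg_cst.
exact: mulg_continuous.
Qed.

Lemma compact_ltrans x (K : set G) : compact K -> compact (ltrans x K).
Proof.
move=> cK; apply: continuous_compact => //.
exact/continuous_subspaceT/mulg_cts.
Qed.

Lemma measurable_ltrans x (A : set (borel G)) : measurable A ->
  measurable (ltrans x A : set (borel G)).
Proof.
move=> mA; rewrite ltransE -[X in measurable X]setTI.
have /(_ measurableT A mA) // : measurable_fun setT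
  ((fun y => (x^-1 * y)%g) : borel G -> borel G).
apply: (@measurability _ _ (borel G) (borel G) setT _ (@open G)) => //.
move=> _ [U oU <-]; rewrite setTI; apply: sub_sigma_algebra.
by apply: open_comp => // y _; exact: mulg_cts.
Qed.

Lemma ltransK x (A : set G) : ltrans x (ltrans x^-1%g A) = A.
Proof.
by rewrite !ltransE; apply/seteqP; split => y /=; rewrite invgK mulVKg.
Qed.

Lemma haar_ltrans x (A : set G) : ((haar_mu mu)^* (ltrans x A) = (haar_mu mu)^* A)%E.
Proof.
suff le y B : ((haar_mu mu)^* (ltrans y B) <= (haar_mu mu)^* B)%E.
  by apply/eqP; rewrite eq_le le/= -{1}[A](ltransK x^-1%g) invgK le.
apply: le_ereal_inf_tmp => _ [F [mF BF] <-].
apply: ereal_inf_lbound; exists (fun k => ltrans y (F k)).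
  split => [k|_ [z /BF[k _ Fkz] <-]]; first exact: measurable_ltrans.
  by exists k => //; exists z.
by apply: eq_eseriesr => k _; rewrite haar_left.
Qed.

Lemma ltransI x (A B : set G) : ltrans x (A `&` B) = ltrans x A `&` ltrans x B.
Proof. by rewrite !ltransE preimage_setI. Qed.

Lemma ltransC x (A : set G) : ltrans x (~` A) = ~` ltrans x A.
Proof. by rewrite !ltransE preimage_setC. Qed.

Lemma hmeasurable_ltrans x (A : set (hmeas mu)) : measurable A ->
  measurable (ltrans x A : set (hmeas mu)).
Proof.
move=> mA; suff: (haar_mu mu)^*.-caratheodory (ltrans x A) by [].
move=> X; rewrite -[X](ltransK x) -ltransC -!ltransI !(haar_ltrans x).
exact: (mA (ltrans x^-1%g X)).
Qed.

Lemma ess_haar_ltrans x (A : set (hmeas mu)) :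
  (ess_haar mu (ltrans x A) <= ess_haar mu A)%E.
Proof.
apply: ge_ereal_sup => _ [K cK <-].
rewrite -[K](ltransK x) -ltransI haar_ltrans.
exact/ess_haar_sup/compact_ltrans.
Qed.

Lemma ae_ltrans x (P : G -> Prop) : (\forall y \ae ess_haar mu, P y) ->
  \forall y \ae ess_haar mu, P (x^-1 * y)%g.
Proof.
move=> [A [mA A0 PA]]; exists (ltrans x A); split.
- exact: hmeasurable_ltrans.
- by apply/eqP; rewrite eq_le measure_ge0 andbT -A0 ess_haar_ltrans.
- by rewrite ltransE => y /= Py; exact: PA.
Qed.

Lemma ltransl_Linfty (x : G) (phi : Linfty mu) :
  (fun y => phi (x^-1 * y)%g) \in @Lfun _ (hmeas mu) R (ess_haar mu) +oo%E.
Proof.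
rewrite inE; apply/andP; split; rewrite inE /=.
  move=> _ Y mY; rewrite setTI.
  have := @measurable_funPT _ _ _ _ phi measurableT Y mY.
  by rewrite setTI => /(hmeasurable_ltrans x); rewrite ltransE.
rewrite /finite_norm unlock; case: ifPn => // G0.
apply: (@le_lt_trans _ _ 'N[ess_haar mu]_+oo[EFin \o phi]%E); last exact: Lfunction_finite.
rewrite unlock G0; apply/ess_supP.
apply: (@ae_ltrans x (fun y => (`|(phi y)%:E| <= _)%E)).
exact: ess_sup_ge.
Qed.

Definition ltransl (x : G) (phi : Linfty mu) : Linfty mu :=
  Lfun_Sub _ (ltransl_Linfty x phi).

Definition chi (E : set (hmeas mu)) (mE : measurable E) : Linfty mu :=
  Lfun_Sub _ (indic_Linfty (ess_haar mu) mE).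

Lemma compact_borel (A : set G) : compact A -> measurable (A : set (borel G)).
Proof.
move=> cA; rewrite -[A]setCK; apply: measurableC; apply: sub_sigma_algebra.
exact/closed_openC/(compact_closed lcg_hausdorff).
Qed.

Lemma compact_hmeas (A : set G) : compact A -> measurable (A : set (hmeas mu)).
Proof.
move=> cA; apply: sub_caratheodory; apply: sub_sigma_algebra.
exact: compact_borel.
Qed.

Lemma unif_L1 (A : set G) : compact A ->
  (fun x => \1_A x / fine (mu A)) \in @Lfun _ (hmeas mu) R (ess_haar mu) 1%E.
Proof.
move=> cA; apply: (indic_L1 _ (compact_hmeas cA)).
apply: le_lt_trans (haar_compact mu cA); apply: ge_ereal_sup => _ [K cK <-].
rewrite -(measurable_mu_extE (haar_mu mu) (compact_borel cA)).
by apply: le_outer_measure; exact: subIsetl.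
Qed.

Definition unif (A : set G) (cA : compact A) : L1 mu := Lfun_Sub _ (unif_L1 cA).

Definition dual_norm (m : {scalar Linfty mu}) : \bar R :=
  ereal_sup [set `|m phi|%:E | phi in
    [set phi : Linfty mu | ('N[ess_haar mu]_+oo[EFin \o phi] <= 1)%E]].

Definition means : set {scalar Linfty mu} := [set m | dual_norm m = 1%E /\
  forall phi : Linfty mu,
    (\forall x \ae ess_haar mu, 0 <= phi x) -> 0 <= m phi].

Definition LIM : set {scalar Linfty mu} := [set m | means m /\
  forall (x : G) (phi : Linfty mu), m phi = m (ltransl x phi)].

Definition folner_sets (K : set G) (eps : R) : set (set G) :=
  [set A | [/\ compact A, (0 < mu A)%E &
    forall x, K x -> fine (mu (ltrans x A `+` A)) / fine (mu A) < eps]].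

Definition finite_measurable_partition (P : set (set (hmeas mu))) :=
  [/\ finite_set P, partition P id [set: G] & forall E, P E -> measurable E].

Definition mean_nbhs (m : {scalar Linfty mu}) (P : set (set (hmeas mu)))
    (eps : R) : set {scalar Linfty mu} :=
  [set n | means n /\ forall (E : set (hmeas mu)) (mE : measurable E), P E ->
    `|m (chi mE) - n (chi mE)| < eps].

Definition LIM0 : set {scalar Linfty mu} := [set m | LIM m /\
  forall (P : set (set (hmeas mu))) (K : set G) (eps : R),
    finite_measurable_partition P -> finite_set K -> 0 < eps < 1 ->
    exists A (cA : compact A),
      folner_sets K eps A /\ mean_nbhs m P eps (L1_dual (unif cA))].

End dual.
Arguments means {R G} mu _.
Arguments LIM {R G} mu _.
Arguments LIM0 {R G} mu _.
Arguments folner_sets {R G} mu K eps _.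

(* Main.v *)
Require Import Defs.
From mathcomp Require Import all_boot all_order all_algebra.
From mathcomp Require Import all_classical all_reals all_analysis.
From mathcomp Require Import measurable_realfun ess_sup_inf ring lra.

Set Implicit Arguments.
Unset Strict Implicit.
Unset Printing Implicit Defensive.
Import Order.TTheory GRing.Theory Num.Theory.
Import numFieldNormedType.Exports.

Local Open Scope classical_set_scope.
Local Open Scope ring_scope.
Local Open Scope measure_scope.

(** Let [m] be a left-invariant mean, [E_1], ..., [E_n] measurable sets and
    [p_i = m(E_i)].  One has to find a single compact set that is nearly
    invariant under finitely many elements [x_1], ..., [x_k] (a Folner set) and
    in which each [E_i] has density close to [p_i].

    The heart of the matter is [exists_folner_below_mean]: if [psi] is bounded,
    [S] is sigma-compact and [eta > 0], some Folner set disjoint from [S] gives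
    [psi] an average of at most [m psi + eta].  Suppose not, put
    [c = m psi + eta], and let [H] be a sigma-compact open subgroup that contains
    [S] and the [x_i].  Outside [H], every Folner set [B] has
    [\int_B (psi - c) >= 0], and every compact set that is not a Folner set has
    a large boundary; so all sets [A] of finite measure satisfy
    [\int_A (psi - c) + lam * \sum_i |x_i A `+` A| >= 0] for a suitable [lam].
    This is the cut condition of the max-flow min-cut theorem for the graph
    whose edges join [y] to [x_i y], with capacity [lam].  The corresponding flow
    consists of functions [phi_i] with values in [-lam, lam] such that
    [psi - c + \sum_i (phi_i(x_i y) - phi_i(y)) >= 0] almost everywhere outside
    [H].  Now apply [m].  The differences [phi_i(x_i y) - phi_i(y)] have mean
    zero by invariance, and [H] is invisible to [m]
    ([LIM_sigma_compact_open_subgroup]), because it has infinitely many disjoint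
    translates as [G] is not sigma-compact.  Hence [m psi - c >= 0], whereas
    [m psi - c = - eta].

    The flow is built on one right coset [H y] at a time, where Haar measure is
    sigma-finite, by minimizing the energy [\int w ((psi - c + div phi)^-)^2] for
    a positive integrable weight [w] ([flow_exists]).  At a minimizer the function
    [rho = w (psi - c + div phi)^-] is integrable, and testing optimality against
    the flow [lam * sg (rho(x_i^-1 y) - rho(y))] bounds the energy by minus the
    left-hand side of the cut condition for [rho]; by the coarea principle
    ([cut_cost_ge0]) this is a sum of contributions of the level sets of [rho], so
    the energy is zero.  That the infimum is attained follows from the
    parallelogram law.  The flows of the different cosets are then glued; that
    the result is measurable, and that its exceptional set is null, can be tested
    on compact sets, which meet only finitely many cosets.

    Finally, Folner sets are put together.  Because [S] is an arbitrary
    sigma-compact set, a compactness argument over the directions of R^n yields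
    Folner sets whose volumes stay in one fixed interval
    ([exists_uniform_volume]), countably many excluded sets being merged into
    one.  Starting from any Folner set, one keeps adding a disjoint one whose
    vector of discrepancies [|B `&` E_i| - p_i |B|] points away from the vector
    accumulated so far.  The squared length of the accumulated vector then grows
    slower than the squared volume ([exists_balanced_folner]), and a disjoint
    union of Folner sets is a Folner set. *)

(** * Integrals of real-valued functions *)

Notation integrableR m f := (m.-integrable [set: _] (EFin \o f)).

Section real_integrals.
Context d (T : measurableType d) (R : realType) (m : {measure set T -> \bar R}).
Implicit Types (f h : T -> R).
Local Notation itg f := (integrableR m f).

Lemma integrableR_measurable f : itg f -> measurable_fun setT f.
Proof. by move=> /measurable_int /measurable_EFinP. Qed.

Lemma le_integrableR f h : measurable_fun setT f -> (forall y, `|f y| <= h y) ->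
  itg h -> itg f.
Proof.
move=> mf fh; apply: le_integrable => //; first exact/measurable_EFinP.
by move=> y _ /=; rewrite lee_fin (le_trans (fh y))// ler_norm.
Qed.

Lemma integrableRD f h : itg f -> itg h -> itg (fun y => f y + h y).
Proof. by move=> jf jh; apply: eq_integrable (integrableD _ jf jh). Qed.

Lemma integrableRB f h : itg f -> itg h -> itg (fun y => f y - h y).
Proof. by move=> jf jh; apply: eq_integrable (integrableB _ jf jh). Qed.

Lemma integrableRZ c f : itg f -> itg (fun y => c * f y).
Proof. by move=> jf; apply: eq_integrable (integrableZl _ c jf). Qed.

Lemma integrableR_norm f : itg f -> itg (fun y => `|f y|).
Proof. exact: integrable_norm. Qed.

Lemma integrableR0 : itg (fun=> 0).
Proof. exact: integrable0. Qed.

Lemma integrableR_sum n (F : 'I_n -> T -> R) : (forall i, itg (F i)) ->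
  itg (fun y => \sum_i F i y).
Proof.
move=> jF; have := @integrable_sum _ T R m setT measurableT _ (index_enum 'I_n) predT
  (fun i => EFin \o F i) (fun i _ => jF i).
by apply: eq_integrable => // y _ /=; rewrite sumEFin.
Qed.

Lemma integrableRM f h M : itg f -> measurable_fun setT h -> (forall y, `|h y| <= M) ->
  itg (fun y => f y * h y).
Proof.
move=> jf mh hM; apply: (le_integrableR _ _ (integrableRZ M (integrableR_norm jf))).
  by apply: measurable_funM => //; exact: integrableR_measurable.
by move=> y; rewrite normrM mulrC ler_wpM2r.
Qed.

Lemma integrableR_indic A : measurable A -> (m A < +oo)%E -> itg \1_A.
Proof.
move=> mA Afin; apply/integrableP; split; first exact/measurable_EFinP/measurable_indic.
rewrite (eq_integral (fun x => (\1_A x)%:E)); last by move=> x _; rewrite /= ger0_norm.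
by rewrite integral_indic// setIT.
Qed.

Lemma Rintegral_indic A : measurable A -> \int[m]_y \1_A y = fine (m A).
Proof. by move=> mA; rewrite /Rintegral integral_indic// setIT. Qed.

Lemma Rintegral_sum n (F : 'I_n -> T -> R) : (forall i, itg (F i)) ->
  \int[m]_y (\sum_i F i y) = \sum_i \int[m]_y F i y.
Proof.
elim: n F => [|n ih] F jF.
  rewrite big_ord0; under eq_Rintegral do rewrite big_ord0.
  by rewrite /Rintegral integral0.
rewrite big_ord_recl -ih//; under eq_Rintegral do rewrite big_ord_recl.
by rewrite RintegralD//; exact: integrableR_sum.
Qed.

Lemma Rintegral_le f h : itg f -> itg h -> (forall y, f y <= h y) ->
  \int[m]_y f y <= \int[m]_y h y.
Proof. by move=> jf jh fh; apply: le_Rintegral. Qed.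

Lemma Rintegral_norm f : itg f -> `|\int[m]_y f y| <= \int[m]_y `|f y|.
Proof. by move=> jf; apply: le_normr_Rintegral. Qed.

Lemma Rintegral_cvg0 (F : nat -> T -> R) h : (forall n, measurable_fun setT (F n)) ->
  itg h -> (forall n y, 0 <= F n y <= h y) ->
  (forall y, (fun n => F n y) @ \oo --> 0) ->
  (fun n => \int[m]_y F n y) @ \oo --> 0.
Proof.
move=> mF jh Fh F0.
have [_ _] : [/\ m.-integrable setT (cst 0%E),
    (fun n => \int[m]_y `|(F n y)%:E - 0|)%E @ \oo --> 0%E &
    (fun n => \int[m]_y (F n y)%:E)%E @ \oo --> (\int[m]_y cst 0 y)%E].
  apply: (@dominated_convergence _ T R m setT measurableT
    (fun n => EFin \o F n) _ (EFin \o h)) => //.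
  - by move=> n; exact/measurable_EFinP.
  - by apply: aeW => y _; apply/fine_cvgP; split; [exact: nearW|exact: F0].
  - by apply: aeW => y n _ /=; have /andP[? ?] := Fh n y; rewrite lee_fin ger0_norm.
by rewrite integral0 => /fine_cvg.
Qed.

End real_integrals.

Section invariant_integrals.
Context d (T : measurableType d) (R : realType) (m : {measure set T -> \bar R}).
Variable f : T -> T.
Hypotheses (mf : measurable_fun setT f)
  (minv : forall A, measurable A -> m (f @^-1` A) = m A).

Lemma integrable_comp_invariant (h : T -> R) : integrableR m h ->
  integrableR m (h \o f).
Proof.
move=> /integrableP[mh hoo]; apply/integrableP; split.
  by apply/measurable_EFinP; apply: measurableT_comp => //; exact/measurable_EFinP.
rewrite -(ge0_integral_pushforward mf m (D := setT) (f := fun y => `|(h y)%:E|%E))//.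
  by rewrite (@eq_measure_integral _ _ _ _ m)// => A mA _; exact: minv.
exact: measurableT_comp.
Qed.

Lemma Rintegral_comp_invariant (h : T -> R) : integrableR m h ->
  \int[m]_y h (f y) = \int[m]_y h y.
Proof.
move=> jh; have mh := measurable_int _ jh; congr fine.
have := @integral_pushforward _ _ _ _ R f mf m setT (EFin \o h) mh
  (integrable_comp_invariant jh) measurableT.
rewrite preimage_setT => <-.
by apply: eq_measure_integral => A mA _; exact: minv.
Qed.

End invariant_integrals.

(** * Thresholds, minimizing sequences and negative parts *)

(** The indicators of the conditions [s k <= a] all change in the same direction
    when [a] moves, so no cancellation occurs in the sum.  This is what makes
    [cut_cost] additive over the level sets of a function. *)
Lemma threshold_sum_dist (R : realDomainType) n (s : 'I_n -> R) (a b : R) :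
  `|\sum_k (s k <= a)%R%:R - \sum_k (s k <= b)%R%:R| =
  \sum_k `|(s k <= a)%R%:R - (s k <= b)%R%:R| :> R.
Proof.
wlog ab : a b / b <= a.
  move=> H; have [/H//|/ltW/H] := leP b a.
  by rewrite distrC => ->; apply: eq_bigr => k _; rewrite distrC.
have le k : (s k <= b)%R%:R <= (s k <= a)%R%:R :> R.
  by rewrite ler_nat; case: (leP (s k) b) => // /le_trans->.
rewrite -sumrB ger0_norm; last by apply: sumr_ge0 => k _; rewrite subr_ge0.
by apply: eq_bigr => k _; rewrite ger0_norm// subr_ge0.
Qed.

Lemma threshold_sum_floor (R : realDomainType) n (t : R) : 0 <= t <= n%:R ->
  t - 1 <= \sum_(k < n) (k.+1%:R <= t)%R%:R <= t.
Proof.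
elim: n => [|n ih] /andP[t0 tn]; first by rewrite big_ord0; lra.
rewrite big_ord_recr/=; have [tn'|nt] := leP t n%:R.
  have -> : (n.+1%:R <= t) = false by apply/negbTE; rewrite -ltNge -natr1 (le_lt_trans tn')// ltrDl.
  by rewrite addr0 ih// t0.
rewrite (eq_bigr (fun=> 1)) => [|k _]; last by rewrite (le_trans _ (ltW nt))// ler_nat.
rewrite sumr_const card_ord; move: tn; rewrite -natr1 => tn.
by case: (boolP (n%:R + 1 <= t)) => ? /=; lra.
Qed.

Section nested_convex.
Context (R : realType) (V : Type) (q : V -> R) (dist : V -> V -> R)
  (mid : V -> V -> V) (C : nat -> set V).

(** Near-minimizers of a quadratic form [q] on a decreasing sequence of convex
    sets form a Cauchy sequence: the midpoint of two of them lies in the larger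
    of the two sets, so that its value is at least the minimum there, and the
    parallelogram law bounds the distance.  Only midpoints enter, so [q], the
    distance and the midpoint are kept abstract. *)
Lemma nested_convex_near_minimizers (Q : R) (theta : nat -> R) :
  (forall n, C n.+1 `<=` C n) -> (forall n, C n !=set0) ->
  (forall n a b, C n a -> C n b -> C n (mid a b)) ->
  (forall a, C 0%N a -> 0 <= q a <= Q) ->
  (forall a b, C 0%N a -> C 0%N b -> dist a b = 2 * q a + 2 * q b - 4 * q (mid a b)) ->
  (forall n, 0 < theta n.+1 <= theta n) ->
  exists v : nat -> V, forall n, C n (v n) /\ dist (v n) (v n.+1) <= theta n.
Proof.
move=> Cdecr C0 Cmid qQ para th.
have Cle n p : (n <= p)%N -> C p `<=` C n.
  move=> /subnK <-; elim: (p - n)%N => [//|j ih]; rewrite addSn.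
  exact: subset_trans (Cdecr _) ih.
have C00 n : C n `<=` C 0%N by exact: Cle.
have th0 n : 0 < theta n by have /andP[/lt_le_trans] := th n; exact.
pose dn n := inf (q @` C n).
have hi n : has_inf (q @` C n).
  split; first by case: (C0 n) => a Ca; exists (q a), a.
  by exists 0 => _ [a /C00/qQ/andP[? _] <-].
have dle n a : C n a -> dn n <= q a by move=> Ca; apply: ge_inf; [case: (hi n)|exists a].
have dmono n p : (n <= p)%N -> dn n <= dn p.
  move=> np; apply: lb_le_inf; first by case: (hi p).
  by move=> _ [a /(Cle _ _ np) Ca <-]; exact: dle.
have hs : has_sup (range dn).
  split; first by exists (dn 0%N), 0%N.
  exists Q => _ [n _ <-]; have [a Ca] := C0 n.
  by rewrite (le_trans (dle _ _ Ca))//; have /andP[] := qQ _ (C00 _ _ Ca).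
pose D := sup (range dn).
have dD n : dn n <= D by apply: ub_le_sup; [case: hs|exists n].
have /choice[N HN] n : exists p, (n <= p)%N /\ D - theta n / 8 <= dn p.
  have e0 : 0 < theta n / 8 by rewrite divr_gt0.
  have [_ [p _ <-] Hp] := sup_adherent e0 hs.
  exists (maxn n p); rewrite leq_maxl; split => //.
  by rewrite (le_trans (ltW Hp))// dmono// leq_maxr.
have /choice[v Hv] n : exists a, C (N n) a /\ q a <= D + theta n / 8.
  have e0 : 0 < theta n / 8 by rewrite divr_gt0.
  have [_ [a Ca <-] Ha] := inf_adherent e0 (hi (N n)).
  by exists a; split => //; rewrite (le_trans (ltW Ha))// lerD2r dD.
exists v => n; have [CN qN] := Hv n; have [CN1 qN1] := Hv n.+1.
split; first by apply: Cle CN; case: (HN n).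
rewrite para; [|exact: C00 CN|exact: C00 CN1].
(* [N n] need not be monotone; the midpoint lies in the set of smaller index. *)
have mD : D - theta n / 8 <= q (mid (v n) (v n.+1)).
  have [NN|NN] := leqP (N n) (N n.+1).
    by rewrite (le_trans (proj2 (HN n)))// dle//; apply: Cmid => //; exact: Cle NN _ CN1.
  rewrite (@le_trans _ _ (dn (N n.+1)))//.
    rewrite (le_trans _ (proj2 (HN n.+1)))// lerD2l lerN2 ler_pM2r ?invr_gt0//.
    by have /andP[] := th n.
  by rewrite dle//; apply: Cmid => //; exact: Cle (ltnW NN) _ CN.
by have /andP[_] := th n; lra.
Qed.

End nested_convex.

Section negative_part.
Context (R : realDomainType).

Definition negp (r : R) := Num.max (- r) 0.

Lemma negp_ge0 r : 0 <= negp r.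
Proof. by rewrite /negp le_max lexx orbT. Qed.

Lemma negp_le r : negp r <= `|r|.
Proof. by rewrite /negp ge_max normr_ge0 andbT -normrN ler_norm. Qed.

Lemma negpM r : negp r * r = - negp r ^+ 2.
Proof. by rewrite /negp; case: (leP (- r) 0) => ? ; ring. Qed.

End negative_part.

Section negative_part_field.
Context (R : realFieldType).
Implicit Types r s : R.

(** The function [r |-> negp r ^+ 2] is convex with derivative [- 2 * negp r] and
    second derivative at most 2. *)
Lemma negp_sqrD r s : negp (r + s) ^+ 2 <= negp r ^+ 2 - 2 * (negp r * s) + s ^+ 2.
Proof.
rewrite /negp; case: (leP (- (r + s)) 0) => rs0; case: (leP (- r) 0) => r0.
- by have := sqr_ge0 s; lra.
- by have := sqr_ge0 (r + s); nra.
- have : 0 <= r * - (r + s) by rewrite mulr_ge0//; lra.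
  have : 0 <= r * - s by rewrite mulr_ge0//; lra.
  by nra.
- by rewrite le_eqVlt; apply/orP; left; apply/eqP; ring.
Qed.

Lemma negp_sqr_mid r s :
  negp (2^-1 * (r + s)) ^+ 2 <= 2^-1 * (negp r ^+ 2 + negp s ^+ 2).
Proof.
have H : negp (2^-1 * (r + s)) <= 2^-1 * (negp r + negp s).
  by rewrite /negp; case: (leP (- (2^-1 * (r + s))) 0) => ?; case: (leP (- r) 0) => ?;
     case: (leP (- s) 0) => ?; lra.
apply: (@le_trans _ _ ((2^-1 * (negp r + negp s)) ^+ 2)).
  by rewrite ler_sqr// nnegrE ?mulr_ge0 ?addr_ge0 ?negp_ge0.
by have := sqr_ge0 (negp r - negp s); nra.
Qed.

End negative_part_field.

Lemma measurable_sg (R : realType) : measurable_fun setT (Num.sg : R -> R).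
Proof.
apply: nondecreasing_measurable => // x y; case: (sgrP x); case: (sgrP y) => *; lra.
Qed.

Lemma sum_halves_le (R : realFieldType) n : \sum_(0 <= i < n) (2^-1 : R) ^+ i <= 2.
Proof.
suff -> : \sum_(0 <= i < n) (2^-1 : R) ^+ i = 2 - 2 * 2^-1 ^+ n.
  by rewrite gerBl mulr_ge0// exprn_ge0// invr_ge0.
elim: n => [|n ih]; first by rewrite big_geq// expr0 mulr1 subrr.
by rewrite big_nat_recr//= ih exprS; field.
Qed.

Lemma nonneg_bounded_series_cvg (R : realType) (a : nat -> R) M :
  (forall n, 0 <= a n) -> (forall n, \sum_(0 <= i < n) a i <= M) -> cvgn (series a).
Proof.
move=> a0 aM; apply: nondecreasing_is_cvgn.
  apply/nondecreasing_seqP => n; rewrite /series/= big_nat_recr//= lerDl//.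
by exists M => _ [n _ <-]; exact: aM.
Qed.

Lemma ae_summable d (T : measurableType d) (R : realType) (m : {measure set T -> \bar R})
    (h : nat -> T -> R) c :
  (forall n y, 0 <= h n y) -> (forall n, integrableR m (h n)) ->
  (forall n, \int[m]_y h n y <= c * 2^-1 ^+ n) ->
  {ae m, forall y, exists M, forall n, \sum_(0 <= i < n) h i y <= M}.
Proof.
move=> h0 jh hc.
have mh n : measurable_fun setT (EFin \o h n) by exact: measurable_int (jh n).
pose H y := (\sum_(0 <= n <oo) (h n y)%:E)%E.
have H0 y : (0 <= H y)%E by apply: nneseries_ge0 => n _ _; rewrite lee_fin.
have c0 : 0 <= c by have := hc 0%N; rewrite mulr1; apply: le_trans; exact: Rintegral_ge0.
have jH : m.-integrable setT H.
  apply/integrableP; split.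
    have hE0 n y : [set: T] y -> predT n -> (0 <= (h n y)%:E)%E by rewrite lee_fin.
    exact: ge0_emeasurable_sum hE0 (fun n _ => mh n).
  under eq_integral do rewrite gee0_abs//.
  rewrite integral_nneseries//; last by move=> n y _; rewrite lee_fin.
  apply: (@le_lt_trans _ _ (c * 2)%:E); last exact: ltry.
  apply: lime_le.
    by apply: is_cvg_nneseries => n _ _; apply: integral_ge0 => y _; rewrite lee_fin.
  apply: nearW => n.
  rewrite (_ : (\sum_(_ <= _ < _) _)%E = (\sum_(0 <= i < n) \int[m]_y h i y)%:E); last first.
    rewrite -sumEFin; apply: eq_bigr => i _; rewrite /Rintegral fineK//.
    exact: (integrable_fin_num measurableT (jh i)).
  rewrite lee_fin; apply: (@le_trans _ _ (c * \sum_(0 <= i < n) 2^-1 ^+ i)).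
    by rewrite mulr_sumr ler_sum.
  by rewrite ler_wpM2l// sum_halves_le.
apply: filterS (integrable_ae measurableT jH) => y /(_ I) Hfin.
exists (fine (H y)) => n; rewrite -lee_fin fineK// -sumEFin.
by apply: nneseries_lim_ge => i _ _; rewrite lee_fin.
Qed.

(** * Flows with prescribed capacity *)

Section flow.
Context d (T : measurableType d) (R : realType) (m : {measure set T -> \bar R}).
Context (k : nat) (f g : 'I_k -> T -> T).
Hypothesis fK : forall i, cancel (f i) (g i).
Hypotheses (mf : forall i, measurable_fun setT (f i)) (mg : forall i, measurable_fun setT (g i)).
Hypothesis minv : forall i A, measurable A -> m (f i @^-1` A) = m A.
Context (psi : T -> R) (C lam : R).
Hypotheses (mpsi : measurable_fun setT psi) (psiC : forall y, `|psi y| <= C) (lam0 : 0 <= lam).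

Local Notation itg h := (integrableR m h).

(** For the indicator of [A] this is the integral of [psi] over [A] plus the
    capacity [lam] times the measure of the boundary of [A]; it has to be
    nonnegative for all [A] if the demand [- psi] can be met by a flow. *)
Definition cut_cost (rho : T -> R) : R :=
  \int[m]_y (rho y * psi y) + lam * \sum_i \int[m]_y `|rho (g i y) - rho y|.

Let minvg i A : measurable A -> m (g i @^-1` A) = m A.
Proof.
move=> mA; have mgA : measurable (g i @^-1` A).
  by rewrite -[X in measurable X]setTI; exact: mg.
by rewrite -(minv i mgA); congr (m _); apply/seteqP; split => y /=; rewrite fK.
Qed.

Let itgg i h : itg h -> itg (fun y => h (g i y)).
Proof. exact: (integrable_comp_invariant (mg i) (fun A => @minvg i A)). Qed.

Let itg_diff i h : itg h -> itg (fun y => `|h (g i y) - h y|).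
Proof. by move=> jh; apply/integrableR_norm/integrableRB => //; exact: itgg. Qed.

Lemma cut_cost_lipschitz r s : itg r -> itg s ->
  `|cut_cost r - cut_cost s| <= (C + lam * (2 * k%:R)) * \int[m]_y `|r y - s y|.
Proof.
move=> jr js; have jrs := integrableRB jr js.
have jn := integrableR_norm jrs.
rewrite /cut_cost (_ : _ - _ = \int[m]_y ((r y - s y) * psi y) + lam *
   \sum_i (\int[m]_y `|r (g i y) - r y| - \int[m]_y `|s (g i y) - s y|)); last first.
  under [in RHS]eq_Rintegral do rewrite mulrBl.
  by rewrite RintegralB// ?sumrB; [ring|exact: integrableRM psiC|exact: integrableRM psiC].
apply: le_trans (ler_normD _ _) _; rewrite mulrDl lerD//.
  apply: le_trans (Rintegral_norm (integrableRM jrs mpsi psiC)) _.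
  rewrite -RintegralZl//; apply: Rintegral_le; last first.
  - by move=> y; rewrite normrM mulrC ler_wpM2r.
  - exact: integrableRZ.
  - exact/integrableR_norm/(integrableRM jrs mpsi psiC).
rewrite normrM (ger0_norm lam0) -mulrA ler_wpM2l//.
apply: le_trans (ler_norm_sum _ _ _) _.
rewrite (_ : _ * k%:R * _ = \sum_(i < k) 2 * \int[m]_y `|r y - s y|); last first.
  by rewrite sumr_const card_ord -mulr_natr; ring.
apply: ler_sum => i _.
rewrite -RintegralB//; [|exact: itg_diff|exact: itg_diff].
have jd := integrableRB (itg_diff i jr) (itg_diff i js).
apply: le_trans (Rintegral_norm jd) _.
rewrite (_ : 2 * _ = \int[m]_y (`|r (g i y) - s (g i y)| + `|r y - s y|)); last first.
  rewrite RintegralD//; last exact: (itgg i jn).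
  by rewrite (Rintegral_comp_invariant (mg i) (minvg i) jn); ring.
apply: Rintegral_le; [exact: integrableR_norm|by apply: integrableRD => //; exact: (itgg i jn)|].
move=> y; apply: le_trans (ler_dist_dist _ _) _.
rewrite (_ : _ - _ - _ = (r (g i y) - s (g i y)) - (r y - s y)); last by ring.
exact: ler_normB.
Qed.

(** The coarea principle: up to a small error in L^1, [rho] is a positive
    combination of the indicators of its superlevel sets [rho >= j / N], and
    [cut_cost] is additive on this combination because the sets are nested. *)
Lemma cut_cost_ge0 (X : set T) :
  (forall A, measurable A -> A `<=` X -> (m A < +oo)%E -> 0 <= cut_cost \1_A) ->
  forall (rho : T -> R) M, measurable_fun setT rho -> (forall y, 0 <= rho y <= M) ->
    (forall y, 0 < rho y -> X y) -> itg rho -> 0 <= cut_cost rho.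
Proof.
move=> hX rho M mrho rhoM rhoX jrho.
have M0 : 0 <= M by have /andP[/le_trans] := rhoM point; exact.
pose lev N (j : nat) : R := N.+1%:R^-1 * j.+1%:R.
pose A N (j : nat) := [set y | lev N j <= rho y].
have lev0 N j : 0 < lev N j by rewrite mulr_gt0// invr_gt0.
have mA N j : measurable (A N j).
  rewrite -[X in measurable X]setTI (_ : A N j = rho @^-1` `[lev N j, +oo[%classic).
    exact: mrho.
  by apply/seteqP; split => y /=; rewrite in_itv/= andbT.
have Afin N j : (m (A N j) < +oo)%E.
  have /integrableP[_] := integrableRZ (lev N j)^-1 jrho.
  apply: le_lt_trans; rewrite -[X in (m X <= _)%E]setIT -integral_indic//.
  apply: ge0_le_integral => //.
  - exact/measurable_EFinP/measurable_indic.
  - by apply: measurableT_comp => //; exact/measurable_EFinP/measurable_funM.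
  - move=> y _; rewrite /= lee_fin indicE.
    case: (boolP (y \in A N j)) => [|_]; rewrite ?normr_ge0//.
    rewrite inE /A/= => H; have /andP[? _] := rhoM y.
    by rewrite ger0_norm ?mulr_ge0// ?invr_ge0 ?(ltW (lev0 _ _))// mulrC ler_pdivlMr// mul1r.
have jA N j : itg (\1_(A N j) : T -> R) by exact: integrableR_indic.
have Age0 N j : 0 <= cut_cost \1_(A N j).
  by apply: hX => // y /(lt_le_trans (lev0 _ _)); exact: rhoX.
(* so many levels that [L N / N.+1] exceeds the bound [M] of [rho] *)
pose L N := (Num.truncn (M * N.+1%:R)).+1.
pose rN N (y : T) : R := N.+1%:R^-1 * \sum_(j < L N) \1_(A N j) y.
have jr N : itg (rN N) by apply: integrableRZ; exact: integrableR_sum.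
have indA N j y : \1_(A N j) y = (j.+1%:R <= N.+1%:R * rho y)%R%:R :> R.
  rewrite indicE (_ : (y \in A N j) = (lev N j <= rho y)); last by apply/idP/idP; rewrite inE.
  by rewrite /lev ler_pdivrMl.
have sumE N y : \sum_(j < L N) \1_(A N j) y =
    \sum_(j < L N) (j.+1%:R <= N.+1%:R * rho y)%R%:R :> R.
  by apply: eq_bigr => j _; exact: indA.
have rN0 N : 0 <= cut_cost (rN N).
  suff -> : cut_cost (rN N) = N.+1%:R^-1 * \sum_(j < L N) cut_cost \1_(A N j).
    by rewrite mulr_ge0 ?invr_ge0// sumr_ge0.
  rewrite /cut_cost /rN big_split/= mulrDr; congr (_ + _).
    under eq_Rintegral do rewrite -mulrA mulr_suml.
    rewrite RintegralZl ?Rintegral_sum//; first by move=> j; exact: integrableRM psiC.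
    by apply: integrableR_sum => j; exact: integrableRM psiC.
  rewrite -mulr_sumr mulrCA; congr (_ * _).
  rewrite exchange_big/= mulr_sumr; apply: eq_bigr => i _.
  rewrite -Rintegral_sum => [|j]; last exact: itg_diff.
  rewrite -RintegralZl//; last by apply: integrableR_sum => j; exact: itg_diff.
  apply: eq_Rintegral => y _.
  rewrite -mulrBr normrM ger0_norm ?invr_ge0//; congr (_ * _).
  rewrite !sumE threshold_sum_dist.
  by apply: eq_bigr => j _; rewrite !indA.
have dist_rN N y : 0 <= rho y - rN N y <= N.+1%:R^-1.
  have /andP[r0 rM] := rhoM y.
  have := @threshold_sum_floor R (L N) (N.+1%:R * rho y).
  rewrite /rN sumE; set s := \sum_(_ < _) _.
  have -> : 0 <= N.+1%:R * rho y <= (L N)%:R.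
    rewrite mulr_ge0//= (@le_trans _ _ (M * N.+1%:R))//; first by rewrite mulrC ler_wpM2r.
    by apply/ltW; rewrite truncnS_gt.
  move=> /(_ isT) /andP[s1 s2].
  have N0 : 0 < N.+1%:R^-1 :> R by rewrite invr_gt0.
  have E : N.+1%:R^-1 * (N.+1%:R * rho y) = rho y by rewrite mulKf.
  rewrite -[X in X - _]E -mulrBr mulr_ge0 ?(ltW N0) ?subr_ge0//= -{2}[_^-1]mulr1 ler_pM2l//; lra.
have cvg0 : (fun N => \int[m]_y `|rho y - rN N y|) @ \oo --> 0.
  apply: (Rintegral_cvg0 _ jrho) => [N|N y|y].
  - exact: integrableR_measurable (integrableR_norm (integrableRB jrho (jr N))).
  - have /andP[a b] := dist_rN N y; rewrite normr_ge0/= ger0_norm// gerBl.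
    by rewrite mulr_ge0 ?invr_ge0// sumr_ge0.
  - apply: (squeeze_cvgr _ (cvg_cst 0) (@cvg_harmonic R)).
    apply: nearW => N; have /andP[a b] := dist_rN N y.
    by rewrite normr_ge0 ger0_norm.
rewrite leNgt; apply/negP => neg.
have K0 : 0 < C + lam * (2 * k%:R) + 1.
  by rewrite ltr_pwDr// addr_ge0 ?mulr_ge0// (le_trans _ (psiC point)).
have e0 : 0 < - cut_cost rho / (C + lam * (2 * k%:R) + 1) by rewrite divr_gt0// oppr_gt0.
have /cvgrPdist_lt/(_ _ e0)[N _ /(_ N (leqnn N))] := cvg0.
rewrite sub0r normrN ger0_norm; last exact: Rintegral_ge0.
rewrite /= ltr_pdivlMr// mulrC => H.
have := cut_cost_lipschitz jrho (jr N); have := rN0 N.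
have : 0 <= \int[m]_y `|rho y - rN N y| by exact: Rintegral_ge0.
move: H; rewrite ler_norml mulrDl mul1r; set u := \int[m]_y _; set v := (_ + _ * _) * u; lra.
Qed.

Definition admissible (phi : 'I_k -> T -> R) :=
  forall i, measurable_fun setT (phi i) /\ forall y, `|phi i y| <= lam.

(** The supply [psi] plus the divergence of the flow [phi]. *)
Definition net_flow (phi : 'I_k -> T -> R) y : R :=
  psi y + \sum_i (phi i (f i y) - phi i y).

Let B := C + 2 * k%:R * lam.

Lemma net_flow_le phi y : admissible phi -> `|net_flow phi y| <= B.
Proof.
move=> aphi; apply: le_trans (ler_normD _ _) _; rewrite lerD//.
apply: le_trans (ler_norm_sum _ _ _) _.
rewrite (_ : _ * lam = \sum_(i < k) 2 * lam); last first.
  by rewrite sumr_const card_ord -mulr_natr; ring.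
apply: ler_sum => i _; apply: le_trans (ler_normB _ _) _.
by rewrite mulrC mulrDr mulr1 lerD// (proj2 (aphi i)).
Qed.

Lemma measurable_net_flow phi : admissible phi -> measurable_fun setT (net_flow phi).
Proof.
move=> aphi; apply: measurable_funD => //; apply: measurable_sum => i.
have [mphi _] := aphi i.
by apply: measurable_funB => //; exact: measurableT_comp.
Qed.

Context (w : T -> R) (jw : itg w) (w01 : forall y, 0 <= w y <= 1).

Let w0 y : 0 <= w y. Proof. by have /andP[] := w01 y. Qed.

(** The weighted square norm of the deficit of [phi]. *)
Definition energy phi : R := \int[m]_y (w y * negp (net_flow phi y) ^+ 2).

Definition scale_flow (t : R) (a b : 'I_k -> T -> R) : 'I_k -> T -> R :=
  fun i y => a i y + t * (b i y - a i y).

Lemma admissible_scale t a b : 0 <= t <= 1 -> admissible a -> admissible b ->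
  admissible (scale_flow t a b).
Proof.
move=> /andP[t0 t1] aa ab i; have [ma la] := aa i; have [mb lb] := ab i; split.
  by apply: measurable_funD => //; apply: measurable_funM => //; exact: measurable_funB.
move=> y; rewrite /scale_flow.
have := la y; have := lb y; rewrite !ler_norml => /andP[? ?] /andP[? ?].
by apply/andP; split; nra.
Qed.

Lemma net_flow_scale t a b y : net_flow (scale_flow t a b) y =
  net_flow a y + t * (net_flow b y - net_flow a y).
Proof.
rewrite /net_flow /scale_flow opprD addrACA subrr add0r -sumrB -addrA; congr (_ + _).
rewrite mulr_sumr -big_split/=; apply: eq_bigr => i _; ring.
Qed.

Lemma measurable_negp (h : T -> R) : measurable_fun setT h ->
  measurable_fun setT (fun y => negp (h y)).
Proof. by move=> mh; apply: measurable_maxr => //; exact: measurableT_comp. Qed.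

Lemma negp_net_flow_le phi y : admissible phi -> `|negp (net_flow phi y)| <= B.
Proof.
move=> aphi; rewrite ger0_norm ?negp_ge0//.
exact: le_trans (negp_le _) (net_flow_le _ aphi).
Qed.

Lemma integrable_energy phi : admissible phi -> itg (fun y => w y * negp (net_flow phi y) ^+ 2).
Proof.
move=> aphi; apply: (@integrableRM _ _ _ _ _ _ (B ^+ 2)) => //.
  by apply: measurable_funX; exact/measurable_negp/measurable_net_flow.
move=> y; rewrite normrX lerXn2r ?nnegrE ?negp_net_flow_le//.
by rewrite (le_trans _ (negp_net_flow_le y aphi)).
Qed.

Hypothesis cut : forall A, measurable A -> A `<=` [set y | 0 < w y] -> (m A < +oo)%E ->
  0 <= cut_cost \1_A.

(** First-order optimality.  With [rho = w * negp (net_flow phi)], moving from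
    [phi] towards [phi'] by [t] changes the energy by
    [- 2 * t * \int rho * (net_flow phi' - net_flow phi)] up to [O(t ^+ 2)].  The
    flow [phi'] that saturates every edge along which [rho] increases has
    [\int rho * net_flow phi' = cut_cost rho >= 0], while
    [\int rho * net_flow phi = - energy phi]; so near-optimality forces the
    energy to be small. *)
Lemma energy_near_min phi t : admissible phi -> 0 < t <= 1 ->
  (forall phi', admissible phi' -> energy phi <= energy phi' + t ^+ 2) ->
  energy phi <= t * (1 + 4 * B ^+ 2 * \int[m]_y w y).
Proof.
move=> aphi /andP[t0 t1] opt.
pose rho y := w y * negp (net_flow phi y).
have mrho' := measurable_negp (measurable_net_flow aphi).
have jrho : itg rho by apply: integrableRM => // y; exact: negp_net_flow_le.
have mrho := integrableR_measurable jrho.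
pose phi' i y := lam * Num.sg (rho (g i y) - rho y).
have aphi' : admissible phi'.
  move=> i; split.
    apply: measurable_funM => //; apply: measurableT_comp; first exact: measurable_sg.
    by apply: measurable_funB => //; exact: measurableT_comp.
  move=> y; rewrite normrM ger0_norm// -{2}[lam]mulr1 ler_wpM2l// normr_sg.
  by case: (_ != 0).
have jM (h : T -> R) (M : R) : measurable_fun setT h -> (forall y, `|h y| <= M) ->
    itg (fun y => rho y * h y).
  by move=> mh hM; exact: integrableRM hM.
have jMphi b : admissible b -> itg (fun y => rho y * net_flow b y).
  move=> ab; apply: jM; first exact: measurable_net_flow.
  by move=> y; exact: net_flow_le.
have E1 : \int[m]_y (rho y * net_flow phi y) = - energy phi.
  rewrite -mulN1r -RintegralZl//; last exact: integrable_energy.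
  by apply: eq_Rintegral => y _; rewrite /rho -mulrA negpM; ring.
have E2 : \int[m]_y (rho y * net_flow phi' y) = cut_cost rho.
  rewrite /net_flow; under eq_Rintegral do rewrite mulrDr mulr_sumr.
  have j1 i : itg (fun y => rho y * phi' i y).
    by have [? ?] := aphi' i; apply: jM.
  have j2 i : itg (fun y => rho y * phi' i (f i y)).
    by have [? ?] := aphi' i; apply: (@jM _ lam) => //; exact: measurableT_comp.
  have jgrho i : itg (fun y => rho (g i y)) by exact: itgg.
  have j3 i : itg (fun y => rho (g i y) * phi' i y).
    by have [mp lp] := aphi' i; apply: (integrableRM _ mp lp).
  rewrite RintegralD//; last 2 first.
  - exact: jM psiC.
  - by apply: integrableR_sum => i; under eq_fun do rewrite mulrBr; exact: integrableRB.
  rewrite /cut_cost; congr (_ + _); rewrite mulr_sumr Rintegral_sum; last first.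
    by move=> i; under eq_fun do rewrite mulrBr; exact: integrableRB.
  apply: eq_bigr => i _; under eq_Rintegral do rewrite mulrBr.
  rewrite RintegralB//.
  have -> : \int[m]_y (rho y * phi' i (f i y)) = \int[m]_y (rho (g i y) * phi' i y).
    rewrite -(Rintegral_comp_invariant (mf i) (minv i) (j3 i)).
    by apply: eq_Rintegral => y _; rewrite fK.
  rewrite -RintegralB//.
  rewrite -RintegralZl//; last first.
    by apply/integrable_norm => //; apply: integrableRB => //; exact: jgrho.
  apply: eq_Rintegral => y _; rewrite -mulrBl /phi' mulrCA; congr (_ * _).
  by rewrite [RHS]normrEsg mulrC.
have J0 : 0 <= cut_cost rho.
  apply: (cut_cost_ge0 cut (M := B) mrho _ _ jrho).
    move=> y; rewrite /rho mulr_ge0 ?negp_ge0//= -[B]mul1r ler_pM ?negp_ge0//.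
      by have /andP[] := w01 y.
    exact: le_trans (ler_norm _) (negp_net_flow_le y aphi).
  move=> y; rewrite /= /rho => H; rewrite lt_neqAle w0 andbT.
  by apply: contraTneq H => <-; rewrite mul0r ltxx.
have t01 : 0 <= t <= 1 by rewrite ltW.
pose dlt y := net_flow phi' y - net_flow phi y.
have mdlt : measurable_fun setT dlt by apply: measurable_funB; exact: measurable_net_flow.
have dltB y : `|dlt y| <= 2 * B.
  apply: le_trans (ler_normB _ _) _; rewrite mulrC mulrDr mulr1.
  by rewrite lerD// net_flow_le.
have step : energy (scale_flow t phi phi') <= energy phi - 2 * t * \int[m]_y (rho y * dlt y)
    + t ^+ 2 * (4 * B ^+ 2 * \int[m]_y w y).
  have je := integrable_energy aphi.
  have jd := jM _ _ mdlt dltB.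
  have jbd := integrableRB je (integrableRZ (2 * t) jd).
  have jw' := integrableRZ (t ^+ 2) (integrableRZ (4 * B ^+ 2) jw).
  have -> : energy phi - 2 * t * \int[m]_y (rho y * dlt y) + t ^+ 2 * (4 * B ^+ 2 * \int[m]_y w y) =
    \int[m]_y (w y * negp (net_flow phi y) ^+ 2 - 2 * t * (rho y * dlt y) +
               t ^+ 2 * (4 * B ^+ 2 * w y)).
    by rewrite RintegralD// RintegralB ?RintegralZl//; exact: integrableRZ.
  apply: Rintegral_le.
  - exact/integrable_energy/admissible_scale.
  - exact: integrableRD.
  - move=> y; rewrite net_flow_scale -/(dlt y).
    apply: le_trans (ler_wpM2l (w0 y) (negp_sqrD _ _)) _.
    have : dlt y ^+ 2 <= 4 * B ^+ 2.
      rewrite -[4](_ : 2 ^+ 2 = 4 :> R); last by rewrite -natrX.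
      by rewrite -exprMn -real_normK ?num_real// lerXn2r ?nnegrE ?(le_trans _ (dltB y)).
    move=> /(ler_wpM2l (w0 y)) /(ler_wpM2l (sqr_ge0 t)).
    by rewrite /rho; nra.
have := opt _ (admissible_scale t01 aphi aphi').
have : \int[m]_y (rho y * dlt y) = cut_cost rho + energy phi.
  under eq_Rintegral do rewrite mulrBr.
  by rewrite RintegralB ?E1 ?E2 ?opprK//; exact: jMphi.
set I := \int[m]_y (rho y * dlt y) in step *.
set W := 4 * _ * _ in step *.
move=> EI le1; have eI : energy phi <= I by rewrite EI lerDr.
have : 2 * t * I <= t ^+ 2 * (1 + W) by lra.
move=> H; have : 2 * energy phi <= t * (1 + W).
  by rewrite -(ler_pM2l t0); nra.
have : 0 <= energy phi by apply: Rintegral_ge0 => y _; rewrite mulr_ge0 ?sqr_ge0.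
lra.
Qed.

Lemma energy_ge0 phi : 0 <= energy phi.
Proof. by apply: Rintegral_ge0 => y _; rewrite mulr_ge0 ?sqr_ge0. Qed.

Lemma energy_small e : 0 < e -> exists phi, admissible phi /\ energy phi <= e.
Proof.
move=> e0.
pose K := 1 + 4 * B ^+ 2 * \int[m]_y w y.
have K1 : 1 <= K.
  rewrite lerDl; apply: mulr_ge0; first by rewrite mulr_ge0 ?sqr_ge0.
  by apply: Rintegral_ge0 => y _.
pose t := Num.min 1 (e / K).
have t0 : 0 < t by rewrite lt_min ltr01 divr_gt0// (lt_le_trans _ K1).
have t1 : t <= 1 by rewrite ge_min lexx.
pose E := energy @` admissible.
have a0 : admissible (fun _ _ => 0).
  by move=> i; split => // y; rewrite normr0.
have hE : has_inf E.
  split; first by exists (energy (fun _ _ => 0)), (fun _ _ => 0).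
  by exists 0 => _ [phi _ <-]; exact: energy_ge0.
have [_ [phi aphi <-] lt_phi] := inf_adherent (exprn_gt0 2 t0) hE.
exists phi; split => //.
apply: (@le_trans _ _ (t * K)); last first.
  by rewrite -ler_pdivlMr ?(lt_le_trans _ K1)// ge_min lexx orbT.
apply: (energy_near_min aphi); first by rewrite t0.
move=> phi' aphi'; apply: le_trans (ltW lt_phi) _; rewrite lerD2r.
by apply: ge_inf; [case: hE|exists phi'].
Qed.

(** Max-flow min-cut.  The admissible flows of energy at most [2 ^- n] are convex
    and nonempty, so near-minimizers of the weighted L^2 norm over these sets
    converge almost everywhere, and the limit has no deficit.  The invariance of
    the support of [w] makes the convergence of [phi i] at [f i y] available. *)
Theorem flow_exists : (forall i y, 0 < w y -> 0 < w (f i y)) ->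
  exists phi, admissible phi /\ {ae m, forall y, 0 < w y -> 0 <= net_flow phi y}.
Proof.
move=> winv.
pose hf : R := 2^-1.
have hf0 : 0 < hf by rewrite invr_gt0.
pose q (a : 'I_k -> T -> R) := \int[m]_y (w y * \sum_i a i y ^+ 2).
pose dist (a b : 'I_k -> T -> R) := \int[m]_y (w y * \sum_i (a i y - b i y) ^+ 2).
pose mid := scale_flow hf.
pose Cn n : set ('I_k -> T -> R) := [set a | admissible a /\ energy a <= hf ^+ n].
have sumI (b : 'I_k -> T -> R) M : (forall i, measurable_fun setT (b i)) ->
    (forall i y, `|b i y| <= M) ->
    itg (fun y => w y * \sum_i b i y ^+ 2).
  move=> mb bM; apply: (@integrableRM _ _ _ _ _ _ (\sum_(i < k) M ^+ 2)) => //.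
    by apply: measurable_sum => i; exact: measurable_funX.
  move=> y; apply: le_trans (ler_norm_sum _ _ _) _; apply: ler_sum => i _.
  by rewrite normrX lerXn2r ?nnegrE// (le_trans _ (bM i y)).
have jq a : admissible a -> itg (fun y => w y * \sum_i a i y ^+ 2).
  by move=> aa; apply: (sumI _ lam) => i; have [? ?] := aa i.
have mB a b i : admissible a -> admissible b -> measurable_fun setT (fun y => a i y - b i y).
  by move=> aa ab; apply: measurable_funB; [case: (aa i)|case: (ab i)].
have bB a b i y : admissible a -> admissible b -> `|a i y - b i y| <= 2 * lam.
  move=> aa ab; apply: le_trans (ler_normB _ _) _; rewrite mulrC mulrDr mulr1.
  by rewrite lerD//; [case: (aa i)|case: (ab i)].
have jd a b : admissible a -> admissible b -> itg (fun y => w y * \sum_i (a i y - b i y) ^+ 2).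
  move=> aa ab; apply: (sumI (fun i y => a i y - b i y) (2 * lam)) => i; first exact: mB.
  by move=> y; exact: bB.
have hf01 : 0 <= hf <= 1 by rewrite ltW// invf_le1// ler1n.
have amid a b : admissible a -> admissible b -> admissible (mid a b) by exact: admissible_scale.
have [v vP] : exists v : nat -> 'I_k -> T -> R,
    forall n, Cn n (v n) /\ dist (v n) (v n.+1) <= (hf ^+ 2) ^+ n.
  apply: (@nested_convex_near_minimizers _ _ q dist mid Cn (\int[m]_y (w y * (k%:R * lam ^+ 2)))).
  - move=> n a [aa ea]; split => //; apply: le_trans ea _; rewrite exprS ger_pMl ?exprn_gt0//.
    by case/andP: hf01.
  - by move=> n; have [phi [? ?]] := energy_small (exprn_gt0 n hf0); exists phi.
  - move=> n a b [aa ea] [ab eb]; split; first exact: amid.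
    apply: (@le_trans _ _ (hf * (energy a + energy b))); last first.
      by rewrite /hf; lra.
    have ja := integrable_energy aa.
    have jb := integrable_energy ab.
    rewrite -RintegralD// -RintegralZl//; last exact: integrableRD.
    apply: Rintegral_le; [|by apply: integrableRZ; exact: integrableRD|].
      exact: (integrable_energy (amid _ _ aa ab)).
    move=> y; rewrite net_flow_scale [leRHS](_ : _ = w y *
      (hf * (negp (net_flow a y) ^+ 2 + negp (net_flow b y) ^+ 2))); last by ring.
    rewrite ler_wpM2l// (_ : _ + _ = 2^-1 * (net_flow a y + net_flow b y)).
      exact: negp_sqr_mid.
    by rewrite /hf; field.
  - move=> a [aa _]; apply/andP; split.
      by apply: Rintegral_ge0 => y _; rewrite mulr_ge0// sumr_ge0// => i _; exact: sqr_ge0.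
    apply: Rintegral_le; first exact: jq.
      by under eq_fun do rewrite mulrC; exact: integrableRZ.
    move=> y; rewrite ler_wpM2l// -[k in k%:R]card_ord mulrC mulr_natr -sumr_const ler_sum// => i _.
    by have [_ /(_ y) ?] := aa i; rewrite -real_normK ?num_real// lerXn2r ?nnegrE.
  - move=> a b [aa _] [ab _].
    have ja := jq _ aa; have jb := jq _ ab; have jm := jq _ (amid _ _ aa ab).
    rewrite -!RintegralZl// -RintegralD//; [|exact: integrableRZ|exact: integrableRZ].
    rewrite -RintegralB//; [|by apply: integrableRD; exact: integrableRZ|exact: integrableRZ].
    apply: eq_Rintegral => y _; rewrite !(mulrCA _ (w y)) -mulrDr -mulrBr; congr (_ * _).
    rewrite !mulr_sumr -big_split -sumrB/=; apply: eq_bigr => i _.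
    by rewrite /mid /scale_flow /hf; field.
  - by move=> n; rewrite !exprn_gt0//= exprS ger_pMl ?exprn_gt0// expr_le1//; case/andP: hf01.
(* Summability of [h] gives both the convergence of [v] and the vanishing of the deficit. *)
pose h n y := w y * (negp (net_flow (v n) y) ^+ 2 + \sum_i `|v n.+1 i y - v n i y|).
have av n : admissible (v n) by case: (vP n) => -[].
have h0 n y : 0 <= h n y by rewrite mulr_ge0// addr_ge0 ?sqr_ge0// sumr_ge0.
have jh1 n := integrable_energy (av n).
have jh2 n : itg (fun y => w y * \sum_i `|v n.+1 i y - v n i y|).
  apply: (@integrableRM _ _ _ _ _ _ (\sum_(i < k) (2 * lam))) => //.
    by apply: measurable_sum => i; apply: measurableT_comp => //; exact: mB.
  move=> y; apply: le_trans (ler_norm_sum _ _ _) _; apply: ler_sum => i _.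
  by rewrite normr_id bB.
have jh n : itg (h n) by rewrite /h; under eq_fun do rewrite mulrDr; exact: integrableRD.
pose W := \int[m]_y w y.
have hc n : \int[m]_y h n y <= (2 + k%:R * W) * 2^-1 ^+ n.
  rewrite /h; under eq_Rintegral do rewrite mulrDr.
  rewrite RintegralD// -/hf.
  have e1 : energy (v n) <= hf ^+ n by case: (vP n) => -[].
  rewrite mulrDl -[2](_ : 1 + 1 = 2)// mulrDl !mul1r -addrA lerD//.
  (* [|a| <= 2 ^- n + 2 ^ n * a ^+ 2] passes from the L^2 to the L^1 distance. *)
  have dn := proj2 (vP n).
  apply: (@le_trans _ _ (2 ^+ n * dist (v n) (v n.+1) + k%:R * hf ^+ n * W)); last first.
    rewrite mulrAC lerD2r// (le_trans (ler_wpM2l _ dn))//.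
    by rewrite exprAC -exprM mulnC exprM -exprMn expr2 mulrA divff// mul1r.
  have jdn := jd _ _ (av n) (av n.+1).
  rewrite -!RintegralZl// -RintegralD//; [|exact: integrableRZ|exact: integrableRZ].
  apply: Rintegral_le => //; first by apply: integrableRD; exact: integrableRZ.
  move=> y; rewrite [leRHS](_ : _ = w y *
      \sum_i (2 ^+ n * (v n i y - v n.+1 i y) ^+ 2 + hf ^+ n)); last first.
    rewrite big_split/= sumr_const card_ord -mulr_sumr -(mulr_natr (hf ^+ n)).
    by move: (hf ^+ n) (2 ^+ n : R) => c s; ring.
  rewrite ler_wpM2l//; apply: ler_sum => i _; rewrite distrC.
  have P0 : 0 < 2 ^+ n :> R by rewrite exprn_gt0.
  have -> : hf ^+ n = (2 ^+ n)^-1 by rewrite exprVn.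
  set x := v n i y - v n.+1 i y; set s := 2 ^+ n.
  rewrite -[x ^+ 2]real_normK ?num_real//; move: P0; rewrite -/s => P0.
  rewrite -(ler_pM2l P0) mulrDr divff ?gt_eqF//.
  by have := sqr_ge0 (s * `|x| - 1); have := normr_ge0 x; nra.
have aeM := ae_summable h0 jh hc.
have aeMf : {ae m, forall y i, exists M, forall n, \sum_(0 <= j < n) h j (f i y) <= M}.
  apply: filter_forall => i; case: aeM => N [mN N0 subN].
  exists (f i @^-1` N); split; [|by rewrite minv|by move=> y /= ny; exact: subN].
  by rewrite -[X in measurable X]setTI; exact: mf.
pose L i y := limn_sup (fun n => v n i y).
(* Clipping keeps the bound at the points without convergence. *)
pose phi i y := Num.max (- lam) (Num.min lam (L i y)).
have vb n i y : - lam <= v n i y <= lam by rewrite -ler_norml; case: (av n i).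
exists phi; split.
  move=> i; split.
    apply: measurable_maxr => //; apply: measurable_minr => //.
    apply: measurable_fun_limn_sup => [y _|y _|n]; last by case: (av n i).
      by exists lam => _ [n _ <-]; case/andP: (vb n i y).
    by exists (- lam) => _ [n _ <-]; case/andP: (vb n i y).
  move=> y; rewrite ler_norml le_max lexx ge_max ge_min lexx/= andbT.
  by rewrite (le_trans _ lam0)// oppr_le0.
have good y : 0 < w y -> (exists M, forall n, \sum_(0 <= j < n) h j y <= M) ->
    (forall i, (fun n => v n i y) @ \oo --> phi i y) /\
    (fun n => negp (net_flow (v n) y)) @ \oo --> 0.
  move=> wy [M hM].
  have HM n : \sum_(0 <= j < n) (negp (net_flow (v j) y) ^+ 2 +
      \sum_i `|v j.+1 i y - v j i y|) <= M / w y.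
    by rewrite ler_pdivlMr// mulrC mulr_sumr.
  split=> [i|].
    have cv : cvgn (fun n => v n i y).
      have cs : cvgn (series (telescope (fun n => v n i y))).
        apply: normed_cvg; apply: (@nonneg_bounded_series_cvg _ _ (M / w y)) => n.
          exact: normr_ge0.
        have : \sum_(0 <= j < n) `|v j.+1 i y - v j i y| <= M / w y.
          apply: le_trans (HM n); apply: ler_sum => j _.
          by rewrite ler_wpDl ?sqr_ge0// (bigD1 i)//= lerDl sumr_ge0.
        exact.
      rewrite (_ : (fun n => v n i y) =
        (fun n => v 0%N i y + series (telescope (fun n => v n i y)) n)).
        by apply: is_cvgD => //; exact: is_cvg_cst.
      by apply/funext => n; exact: eq_sum_telescope.
    have -> : phi i y = limn (fun n => v n i y).
      rewrite /phi /L cvg_limn_supE//.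
      have l1 : - lam <= limn (fun n => v n i y).
        by apply: limr_ge => //; apply: nearW => n; case/andP: (vb n i y).
      have l2 : limn (fun n => v n i y) <= lam.
        by apply: limr_le => //; apply: nearW => n; case/andP: (vb n i y).
      by rewrite min_r// max_r.
    exact: cv.
  have : (fun n => negp (net_flow (v n) y) ^+ 2) @ \oo --> 0.
    apply: cvg_series_cvg_0; apply: (@nonneg_bounded_series_cvg _ _ (M / w y)) => n.
      exact: sqr_ge0.
    by apply: le_trans (HM n); apply: ler_sum => j _; rewrite lerDl sumr_ge0.
  move=> /cvgrPdist_lt c; apply/cvgrPdist_lt => e e0.
  apply: filterS (c _ (exprn_gt0 2 e0)) => n.
  rewrite !sub0r !normrN normrX ltr_pXn2r ?nnegrE//; exact: ltW.
apply: filterS2 aeM aeMf => y My Mfy wy.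
have [cy ny] := good y wy My.
have cu : (fun n => net_flow (v n) y) @ \oo --> net_flow phi y.
  apply: cvgD; first exact: cvg_cst.
  apply: cvg_big => [|i _]; first exact: add_continuous.
  apply: cvgB => //.
  by have [] := good (f i y) (winv i y wy) (Mfy i).
rewrite leNgt; apply/negP => neg.
have e0 : 0 < - net_flow phi y / 2 by rewrite divr_gt0// oppr_gt0.
have /cvgrPdist_lt/(_ _ e0) c1 := cu.
have /cvgrPdist_lt/(_ _ e0) c2 := ny.
have [n] := @filter_ex _ _ _ _ (filterI c1 c2).
case=> /= c1n; rewrite sub0r normrN ger0_norm ?negp_ge0// => c2n.
have : - net_flow (v n) y <= negp (net_flow (v n) y) by rewrite le_max lexx.
by move: c1n; rewrite ltr_norml => /andP[? ?]; lra.
Qed.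

End flow.

(** * Regularity of Haar measure *)

Section haar_regularity.
Context (R : realType) (G : lcGroupType) (mu : haar_measure R G).
Local Notation mus := (haar_mu mu)^*.
Local Notation ess := (ess_haar mu).
Implicit Types (A B E K : set G).

Lemma mus_compact_lty K : compact K -> (mus K < +oo)%E.
Proof.
by move=> cK; rewrite measurable_mu_extE ?haar_compact//; exact: compact_borel.
Qed.

Lemma mus_open_cover E (c : \bar R) : (mus E < c)%E ->
  exists U, [/\ open U, E `<=` U & (mus U < c)%E].
Proof.
move=> /ereal_inf_lt[_ [F [mF EF] <-]] Fc.
have mUF : measurable (\bigcup_i F i : set (borel G)) by exact: bigcup_measurable.
have : (mu (\bigcup_i F i) < c)%E.
  apply: le_lt_trans Fc; rewrite -measurable_mu_extE//.
  apply: le_trans (outer_measure_sigma_subadditive _ _) _.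
  apply: lee_nneseries => [i _ _|i _]; first exact: outer_measure_ge0.
  by rewrite -[leRHS]measurable_mu_extE.
rewrite haar_outer// => /ereal_inf_lt[_ [U [oU FU] <-]] Uc.
exists U; split => //; first exact: subset_trans FU.
by rewrite measurable_mu_extE//; exact: sub_sigma_algebra.
Qed.

Lemma open_hmeas U : open U -> measurable (U : set (hmeas mu)).
Proof.
by move=> oU; apply: sub_caratheodory; apply: sub_sigma_algebra; exact: sub_sigma_algebra.
Qed.

Lemma mus_additive (X : set G) (A : set (hmeas mu)) : measurable A ->
  (mus X = mus (X `&` A) + mus (X `&` ~` A))%E.
Proof. by move=> mA; exact: mA. Qed.

(** Inner regularity inside a compact set [K] comes from the outer regularity of
    [K `\` A]: the complement in [K] of a tight open neighbourhood [V] of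
    [K `\` A] is the compact set sought. *)
Lemma compact_inner K (A : set (hmeas mu)) (e : R) : compact K -> measurable A ->
  A `<=` K -> 0 < e -> exists B, [/\ compact B, B `<=` A & (mus (A `\` B) <= e%:E)%E].
Proof.
move=> cK mA AK e0; set D := K `\` A.
have Kfin := mus_compact_lty cK.
have Dfin : mus D \is a fin_num.
  rewrite ge0_fin_numE ?outer_measure_ge0//; apply: le_lt_trans Kfin.
  by apply: le_outer_measure; exact: subIsetl.
have [|V [oV DV Vlt]] := @mus_open_cover D (mus D + e%:E)%E.
  by rewrite lteDl.
exists (K `\` V); split.
- apply: (subclosed_compact _ cK); last exact: subIsetl.
  by apply: closedI; [exact: (compact_closed lcg_hausdorff cK)|exact: open_closedC].
- move=> y [Ky nVy]; apply: contrapT => nAy; apply: nVy; apply: DV; split => //.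
- have -> : A `\` (K `\` V) = V `&` A.
    apply/seteqP; split => y [].
      move=> Ay nKV; split => //; apply: contrapT => nVy; apply: nKV; split => //; exact: AK.
    by move=> Vy Ay; split => // -[_]; exact.
  have := mus_additive V mA; rewrite -[X in _ = (_ + X)%E -> _]/(mus (V `&` ~` A)) => VE.
  have : (mus (V `&` A) + mus D <= e%:E + mus D)%E.
    rewrite [leRHS]addeC; apply: le_trans (ltW Vlt).
    rewrite VE leeD2l//; apply: le_outer_measure => y Dy; split; [exact: DV|by case: Dy].
  by rewrite leeD2rE.
Qed.

Lemma ess_le_mus A : (ess A <= mus A)%E.
Proof. by apply: ge_ereal_sup => _ [K cK <-]; apply: le_outer_measure; exact: subIsetl. Qed.

Lemma ess_sub_compact K A : compact K -> A `<=` K -> ess A = mus A.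
Proof.
move=> cK AK; apply/eqP; rewrite eq_le ess_le_mus/=.
by rewrite -{1}(setIidl AK) ess_haar_sup.
Qed.

Lemma ess_compact K : compact K -> ess K = mu K.
Proof.
by move=> cK; rewrite (ess_sub_compact cK)// measurable_mu_extE//; exact: compact_borel.
Qed.

Lemma ess_inner (A : set (hmeas mu)) (e : R) : measurable A -> (ess A < +oo)%E -> 0 < e ->
  exists B, [/\ compact B, B `<=` A & (ess (A `\` B) <= e%:E)%E].
Proof.
move=> mA Afin e0.
have Afin' : ess A \is a fin_num by rewrite ge0_fin_numE ?ess_haar_ge0.
have e20 : 0 < e / 2 by rewrite divr_gt0.
have [_ [K cK <-] Klt] := ub_ereal_sup_adherent e20 Afin'.
have mK := compact_hmeas mu cK.
have mAK := measurableI _ _ mA mK.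
have [B [cB BA Be]] := compact_inner cK mAK (@subIsetr _ _ _) e20.
exists B; split => //; first by move=> y /BA[].
have mB := compact_hmeas mu cB.
rewrite [e]splitr EFinD.
have -> : A `\` B = (A `\` K) `|` ((A `&` K) `\` B).
  apply/seteqP; split => y.
    by move=> [Ay nBy]; have [Ky|nKy] := pselect (K y); [right|left].
  move=> [[Ay nKy]|[[Ay _] nBy]]; split => // By; apply: nKy; by have [] := BA _ By.
apply: le_trans (@measureU2 _ _ _ ess _ _ _ _) _; [exact: measurableD|exact: measurableD|].
apply: leeD; last exact: le_trans (ess_le_mus _) Be.
have Klt' : (ess A - (e / 2)%:E < ess (A `&` K))%E.
  by apply: lt_le_trans Klt _; rewrite (ess_sub_compact cK)//; exact: subIsetr.
have AKfin : ess (A `&` K) \is a fin_num.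
  rewrite ge0_fin_numE ?ess_haar_ge0//; apply: le_lt_trans Afin.
  by apply: ess_haar_le; exact: subIsetl.
have := measureDI ess mA mK.
rewrite /= => AE; rewrite AE in Klt'.
have Dfin : ess (A `\` K) \is a fin_num.
  rewrite ge0_fin_numE ?ess_haar_ge0//; apply: le_lt_trans Afin.
  by apply: ess_haar_le; exact: subIsetl.
move: Klt'; rewrite -(fineK AKfin) -(fineK Dfin) -?EFinD -?EFinB -?EFinD lte_fin lee_fin; lra.
Qed.

(** A set of finite outer measure lies in an open set of finite measure, which is
    exhausted by a compact set up to [e / 2]; so the Caratheodory condition for [A]
    follows, up to [e], from the one for [A `&` K]. *)
Lemma locally_hmeas (A : set (hmeas mu)) :
  (forall K, compact K -> measurable (A `&` K : set (hmeas mu))) -> measurable A.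
Proof.
move=> mAK; apply: le_caratheodory_measurable => X.
suff : (mus (X `&` A) + mus (X `&` ~` A) <= mus X)%E by [].
have [->|Xoo] := eqVneq (mus X) +oo%E; first by rewrite leey.
have [|U [oU XU Uoo]] := @mus_open_cover X +oo%E; first by rewrite ltey.
have Ufin : mus U \is a fin_num by rewrite ge0_fin_numE ?outer_measure_ge0.
apply/lee_addgt0Pr => e e0.
have e20 : 0 < e / 2 by rewrite divr_gt0.
have mU : measurable (U : set (borel G)) by exact: sub_sigma_algebra.
have muU : mu U = mus U by rewrite measurable_mu_extE.
have Ufin' : mu U \is a fin_num by rewrite muU.
have [K [[cK KU] Klt]] : exists K, (compact K /\ K `<=` U) /\ (mu U - (e / 2)%:E < mu K)%E.
  move: Ufin'; rewrite {1}haar_inner// => Ufin'.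
  have [_ [K cK <-] Klt] := ub_ereal_sup_adherent e20 Ufin'.
  by exists K; split => //; rewrite haar_inner.
have mK := compact_hmeas mu cK.
have UK : (mus (U `&` ~` K) <= (e / 2)%:E)%E.
  have := mus_additive U mK; rewrite setIidr// => UE.
  have Kfin : mus K \is a fin_num by rewrite ge0_fin_numE ?outer_measure_ge0 ?mus_compact_lty.
  have UKfin : mus (U `&` ~` K) \is a fin_num.
    rewrite ge0_fin_numE ?outer_measure_ge0//; apply: le_lt_trans Uoo.
    by apply: le_outer_measure; exact: subIsetl.
  move: Klt; rewrite muU UE -(@measurable_mu_extE _ _ _ mu K)//; last exact: compact_borel.
  rewrite -(fineK Kfin) -(fineK UKfin) -?EFinD -?EFinB -?EFinD lte_fin lee_fin; lra.
have split1 (Z : set G) : Z `<=` X -> (mus Z <= mus (Z `&` K) + (e / 2)%:E)%E.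
  move=> ZX; rewrite (mus_additive Z mK) leeD2l//;  apply: (le_trans _ UK).
  by apply: le_outer_measure; apply: setSI; exact: subset_trans XU.
apply: le_trans (leeD (split1 _ (@subIsetl _ _ _)) (split1 _ (@subIsetl _ _ _))) _.
rewrite addeACA -EFinD -splitr leeD2r//.
have -> : X `&` A `&` K = (X `&` K) `&` (A `&` K).
  by rewrite setIACA setIid.
have -> : X `&` ~` A `&` K = (X `&` K) `&` ~` (A `&` K).
  apply/seteqP; split => y; first by move=> [[Xy nAy] Ky]; split; [by []|by case].
  by move=> [[Xy Ky] nAK]; split; [split=> // Ay; exact: nAK|].
rewrite -mus_additive; last exact: mAK.
by apply: le_outer_measure; exact: subIsetl.
Qed.

End haar_regularity.

(** * Sigma-compact sets and open subgroups *)

Lemma sigma_finite_weight d (T : measurableType d) (R : realType)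
    (m : {measure set T -> \bar R}) (D : nat -> set T) :
  (forall n, measurable (D n)) -> (forall n, (m (D n) < +oo)%E) ->
  exists w : T -> R, [/\ integrableR m w, forall y, 0 <= w y <= 1 &
    forall y, 0 < w y <-> (\bigcup_n D n) y].
Proof.
move=> mD Dfin.
pose c n : R := 2^-1 ^+ n / 2 / (1 + fine (m (D n))).
have D0 n : 0 <= fine (m (D n)) by rewrite fine_ge0.
have c0 n : 0 < c n by rewrite divr_gt0 ?divr_gt0 ?exprn_gt0 ?invr_gt0 ?ltr_pwDl.
have cle n : c n <= 2^-1 ^+ n / 2.
  by rewrite ler_pdivrMr ?ltr_pwDl// ler_peMr ?lerDl// divr_ge0 ?exprn_ge0 ?invr_ge0.
have cDle n : c n * fine (m (D n)) <= 2^-1 ^+ n / 2.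
  rewrite /c mulrAC ler_pdivrMr ?ltr_pwDl//; apply: ler_wpM2l; last by rewrite lerDr.
  by rewrite divr_ge0 ?exprn_ge0 ?invr_ge0.
pose F n y : R := c n * \1_(D n) y.
have F0 n y : 0 <= F n y by rewrite mulr_ge0 ?(ltW (c0 n)).
pose W y := (\sum_(0 <= n <oo) (F n y)%:E)%E.
have W0 y : (0 <= W y)%E by apply: nneseries_ge0 => n _ _; rewrite lee_fin.
have sum1 (a : nat -> R) : (forall n, 0 <= a n) -> (forall n, a n <= 2^-1 ^+ n / 2) ->
    (\sum_(0 <= n <oo) (a n)%:E <= 1)%E.
  move=> a0 ale; apply: lime_le.
    by apply: is_cvg_nneseries => n _ _; rewrite lee_fin.
  apply: nearW => n; rewrite sumEFin lee_fin.
  apply: (@le_trans _ _ (\sum_(0 <= i < n) 2^-1 ^+ i / 2)); first exact: ler_sum.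
  by rewrite -mulr_suml ler_pdivrMr// mul1r sum_halves_le.
have W1 y : (W y <= 1)%E.
  apply: sum1 => // n; apply: le_trans (cle n).
  by rewrite ler_piMr ?(ltW (c0 n))// indicE lern1 leq_b1.
have Wfin y : W y \is a fin_num by rewrite ge0_fin_numE// (le_lt_trans (W1 y))// ltry.
have mF n : measurable_fun setT (EFin \o F n).
  by apply/measurable_EFinP/measurable_funM => //; exact: measurable_indic.
exists (fun y => fine (W y)); split.
- have -> : EFin \o (fun y => fine (W y)) = W by apply/funext => y /=; rewrite fineK.
  apply/integrableP; split.
    have hE0 n y : [set: T] y -> predT n -> (0 <= (F n y)%:E)%E by rewrite lee_fin.
    exact: ge0_emeasurable_sum hE0 (fun n _ => mF n).
  under eq_integral do rewrite gee0_abs//.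
  rewrite integral_nneseries//; last by move=> n y _; rewrite lee_fin.
  rewrite (eq_eseriesr (g := fun n => (c n * fine (m (D n)))%:E)).
    apply: (@le_lt_trans _ _ 1%E); last exact: ltry.
    by apply: sum1 => // n; rewrite mulr_ge0 ?(ltW (c0 n)).
  move=> n _; under eq_integral do rewrite EFinM.
  rewrite ge0_integralZl ?lee_fin ?(ltW (c0 n))//.
  + by rewrite integral_indic// setIT [in RHS]EFinM fineK// ge0_fin_numE.
  + exact/measurable_EFinP/measurable_indic.
- by move=> y; rewrite fine_ge0//= -lee_fin fineK.
- move=> y; split.
  + move=> Wy; apply: contrapT => nD; suff W00 : W y = 0%E by rewrite W00 ltxx in Wy.
    apply: eseries0 => n _ _; rewrite /F indicE memNset ?mulr0// => Dy.
    by apply: nD; exists n.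
  + move=> [n _ Dy]; rewrite fine_gt0//; apply/andP; split; last by rewrite -ge0_fin_numE.
    apply: (@lt_le_trans _ _ (F n y)%:E).
      by rewrite lte_fin /F indicE mem_set// mulr1.
    have := @nneseries_lim_ge R (fun n => (F n y)%:E) predT 0 n.+1.
    move=> /(_ (fun n _ _ => _)) H; apply: le_trans (H _); last by move=> *; rewrite lee_fin.
    by rewrite big_nat_recr//= leeDr// sume_ge0// => i _; rewrite lee_fin.
Qed.

Section open_subgroups.
Context (G : lcGroupType).
Implicit Types (A B H S : set G).

Definition open_subgroup H := [/\ open H, H 1%g,
  forall x y, H x -> H y -> H (x * y)%g & forall x, H x -> H (x^-1)%g].

Definition sigma_compact A := exists D : nat -> set G,
  (forall n, compact (D n)) /\ A = \bigcup_n D n.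

Lemma sigma_compact_bigcup (A : nat -> set G) : (forall n, sigma_compact (A n)) ->
  sigma_compact (\bigcup_n A n).
Proof.
move=> /choice[D HD]; pose E j := if unpickle j is Some (n, p) then D n p else set0.
exists E; split => [j|].
  by rewrite /E; case: unpickle => [[n p]|]; [case: (HD n)|exact: compact0].
apply/seteqP; split => y [j _].
  have [_ ->] := HD j; move=> [p _ Dy]; exists (pickle (j, p)) => //.
  by rewrite /E pickleK.
rewrite /E; case: unpickle => [[n p]|//] Dy; exists n => //.
by have [_ ->] := HD n; exists p.
Qed.

Lemma compact_sigma_compact A : compact A -> sigma_compact A.
Proof. by move=> cA; exists (fun=> A); split => //; rewrite bigcup_const. Qed.

Lemma sigma_compactU A B : sigma_compact A -> sigma_compact B -> sigma_compact (A `|` B).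
Proof.
move=> sA sB; rewrite -bigcup2E; apply: sigma_compact_bigcup => -[//|[//|n]] /=.
exact/compact_sigma_compact/compact0.
Qed.

Lemma compact_invg A : compact A -> compact [set (x^-1)%g | x in A].
Proof.
move=> cA; apply: continuous_compact => //; apply: continuous_subspaceT.
exact: invg_continuous.
Qed.

Lemma compact_mulg A B : compact A -> compact B ->
  compact [set (z.1 * z.2)%g | z in A `*` B].
Proof.
move=> cA cB; apply: continuous_compact; last exact: compact_setX.
by apply: continuous_subspaceT; exact: mulg_continuous.
Qed.

Lemma mulgr_cts (x : G) : continuous (fun y : G => (y * x)%g).
Proof.
move=> y; apply: (@continuous_comp _ _ _ (fun y => (y, x)) (fun z => z.1 * z.2)%g).
  by apply: cvg_pair => //=; exact: cvg_cst.
exact: mulg_continuous.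
Qed.

Lemma sigma_compact_ltrans x A : sigma_compact A -> sigma_compact (ltrans x A).
Proof.
move=> [D [cD ->]]; exists (fun n => ltrans x (D n)); split => [n|].
  exact: compact_ltrans.
by rewrite /ltrans image_bigcup.
Qed.

Lemma sigma_compact_rtrans x A : sigma_compact A ->
  sigma_compact [set (y * x)%g | y in A].
Proof.
move=> [D [cD ->]]; exists (fun n => [set (y * x)%g | y in D n]); split => [n|].
  by apply: continuous_compact => //; apply/continuous_subspaceT/mulgr_cts.
by rewrite image_bigcup.
Qed.

(** Start from a compact neighbourhood of 1 and close up under products and
    inverses in countably many compact stages, adding one piece of [S] at each. *)
Lemma sigma_compact_sub_open_subgroup S : sigma_compact S ->
  exists H, [/\ open_subgroup H, sigma_compact H & S `<=` H].
Proof.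
move=> [E [cE ->]].
have [W [nW cW]] : exists W : set G, nbhs 1%g W /\ compact W.
  have [W Wn [cW _]] := @lcg_locally_compact G 1%g I.
  have Wn1 : nbhs (1%g : G) [set y | [set: G] y -> W y] := Wn.
  by exists W; split => //; apply: (filterS _ Wn1) => y; exact.
pose step n A := A `|` [set (x^-1)%g | x in A] `|` [set (z.1 * z.2)%g | z in A `*` A] `|` E n.
pose D := fix D n := if n is n'.+1 then step n' (D n') else W.
have cD n : compact (D n).
  elim: n => [//|n ih] /=; rewrite /step; apply: compactU => //.
  apply: compactU; last exact: compact_mulg.
  by apply: compactU => //; exact: compact_invg.
have Dmono n p : (n <= p)%N -> D n `<=` D p.
  move=> /subnK <-; elim: (p - n)%N => [//|j ih]; rewrite addSn.
  by apply: subset_trans ih _ => y Dy; do 3 left.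
have W1 : W 1%g by exact: nbhs_singleton.
have Hmul x y : (\bigcup_n D n) x -> (\bigcup_n D n) y -> (\bigcup_n D n) (x * y)%g.
  move=> [n _ Dx] [p _ Dy]; exists (maxn n p).+1 => //; left; right.
  exists (x, y) => //; split; first exact: Dmono (leq_maxl n p) _ Dx.
  exact: Dmono (leq_maxr n p) _ Dy.
exists (\bigcup_n D n); split.
- split => //.
  + rewrite openE => x Dx; have nx : nbhs x [set y | W (x^-1 * y)%g].
      by apply: (mulg_cts (x := x^-1%g)) => /=; rewrite mulVg.
    apply: (filterS _ nx) => y Wy; rewrite -[y](mulVKg x).
    by apply: Hmul => //; exists 0%N.
  + by exists 0%N.
  + by move=> x [n _ Dx]; exists n.+1 => //; left; left; right; exists x.
- by exists D.
- by move=> y [n _ Ey]; exists n.+1 => //; right.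
Qed.

End open_subgroups.

(** * Invariant means *)

Section means.
Context (R : realType) (G : lcGroupType) (mu : haar_measure R G).
Local Notation ess := (ess_haar mu).
Local Notation Loo := (Linfty mu).

Lemma Linfty_sumE k (f : 'I_k -> Loo) y : (\sum_i f i) y = \sum_i f i y.
Proof. by elim/big_ind2 : _ => // a b f1 c <- <-. Qed.

Lemma bounded_Linfty (f : G -> R) (C : R) :
  measurable_fun setT (f : hmeas mu -> R) -> (forall y, `|f y| <= C) ->
  f \in @Lfun _ (hmeas mu) R ess +oo%E.
Proof.
move=> mf fC; rewrite inE; apply/andP; split; rewrite inE //=.
rewrite /finite_norm unlock; case: ifPn => // G0.
apply: (@le_lt_trans _ _ C%:E); last exact: ltry.
by apply/ess_supP; apply: nearW => x /=; rewrite lee_fin.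
Qed.

Definition bounded_fun_Linfty f C (mf : measurable_fun setT (f : hmeas mu -> R))
  (fC : forall y, `|f y| <= C) : Loo := Lfun_Sub _ (bounded_Linfty mf fC).

Lemma norm_le1_ae (phi : Loo) : ('N[ess]_+oo[EFin \o phi] <= 1)%E ->
  \forall y \ae ess, `|phi y| <= 1.
Proof.
rewrite unlock; case: ifPn => [_ N1|G0 _]; last first.
  exists setT; split => //; apply/eqP; rewrite eq_le ess_haar_ge0 andbT leNgt.
  exact: G0.
have := ess_sup_ge ess (fun y => `|(phi y)%:E|%E).
by apply: filterS => y /le_trans/(_ N1); rewrite lee_fin.
Qed.

Lemma chiT_norm_le1 : ('N[ess]_+oo[EFin \o chi (mu := mu) measurableT] <= 1)%E.
Proof.
rewrite unlock; case: ifPn => // G0.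
by apply/ess_supP; apply: nearW => x /=; rewrite lee_fin indicE in_setT normr1.
Qed.

Context (m : {scalar Loo}) (hm : means mu m).

Lemma mean_ge0 (f : Loo) : (\forall y \ae ess, 0 <= f y) -> 0 <= m f.
Proof. by case: hm => _; exact. Qed.

Lemma mean_le (f g : Loo) : (\forall y \ae ess, f y <= g y) -> m f <= m g.
Proof.
move=> fg; rewrite -subr_ge0 -linearB; apply: mean_ge0.
by apply: filterS fg => y; rewrite -subr_ge0.
Qed.

Lemma mean_one : m (chi measurableT) = 1.
Proof.
have [m1 _] := hm; apply/eqP; rewrite eq_le; apply/andP; split.
  have : (`|m (chi measurableT)|%:E <= dual_norm m)%E.
    by apply: ereal_sup_ubound; exists (chi measurableT) => //; exact: chiT_norm_le1.
  by rewrite m1 lee_fin; apply: le_trans; exact: ler_norm.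
suff : (dual_norm m <= (m (chi measurableT))%:E)%E by rewrite m1 lee_fin.
apply: ge_ereal_sup => _ [phi /norm_le1_ae phi1 <-].
rewrite lee_fin ler_norml; apply/andP; split.
  rewrite -linearN; apply: mean_le; apply: filterS phi1 => y; rewrite ler_norml => /andP[+ _].
  by rewrite -[(- _ : Loo) y]/(- \1_setT y) indicE in_setT.
apply: mean_le; apply: filterS phi1 => y; rewrite ler_norml => /andP[_].
by rewrite -[chi measurableT y]/(\1_setT y) indicE in_setT.
Qed.

End means.

Section null_subgroups.
Context (R : realType) (G : lcGroupType) (mu : haar_measure R G).
Local Notation Loo := (Linfty mu).

Lemma not_sigma_compact : kappa_gt_aleph0 [set: G] -> ~ sigma_compact [set: G].
Proof.
move=> hG [D [cD TD]]; apply: (hG (range D)); last exact: card_image_le.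
split; first by move=> _ [n _ <-].
by rewrite TD => y [n _ Dy]; exists (D n) => //; exists n.
Qed.

(** By invariance the translates of [H] all have the same mean.  A union of finitely
    many left cosets of [H] is sigma-compact, so it misses a point of [G], and
    the coset of that point can be added; hence [N * m(H) <= 1] for all [N]. *)
Lemma LIM_sigma_compact_open_subgroup (m : {scalar Loo}) (H : set G)
    (mH : measurable (H : set (hmeas mu))) :
  kappa_gt_aleph0 [set: G] -> LIM mu m -> open_subgroup H -> sigma_compact H ->
  m (chi mH) = 0.
Proof.
move=> hG [hm minv] [oH H1 HM HV] sH.
have step N : exists (f : Loo) (A : set G), [/\ sigma_compact A,
    (forall y h, A y -> H h -> A (y * h)%g),
    (forall y, f y = \1_A y) & m f = N%:R * m (chi mH)].
  elim: N => [|N [f [A [sA AH fA mf]]]].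
    exists 0, set0; split => //; [exact/compact_sigma_compact/compact0| |].
      by move=> y; rewrite indic0.
    by rewrite linear0 mul0r.
  have [x nAx] : exists x, ~ A x.
    apply: contrapT => /forallNP nA; apply: (not_sigma_compact hG).
    rewrite (_ : setT = A)//; apply/seteqP; split => // y _; apply: contrapT; exact: nA.
  exists (f + ltransl x (chi mH)), (A `|` ltrans x H); split.
  - by apply: sigma_compactU => //; exact: sigma_compact_ltrans.
  - move=> y h [Ay Hh|[z Hz <-] Hh]; first by left; exact: AH.
    by right; exists (z * h)%g; [exact: HM|rewrite mulgA].
  - move=> y; rewrite -[LHS]/(f y + \1_H (x^-1 * y)%g) fA.
    have <- : \1_(ltrans x H) y = \1_H (x^-1 * y)%g :> R.
      by rewrite !indicE ltransE; congr ((nat_of_bool _)%:R); apply/idP/idP; rewrite !inE.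
    rewrite !indicE in_setU; case: (boolP (y \in A)) => [|_]; last by rewrite add0r.
    rewrite inE => Ay; case: (boolP (y \in ltrans x H)) => [|_]; last by rewrite addr0.
    rewrite inE => -[h Hh xhy]; exfalso; apply: nAx.
    by rewrite -[x](mulgK h) xhy; apply: AH => //; exact: HV.
  - by rewrite linearD mf -minv -natr1 mulrDl mul1r.
have m0 : 0 <= m (chi mH) by apply: (mean_ge0 hm); apply: nearW => y.
apply/eqP; rewrite eq_le m0 andbT leNgt; apply/negP => mpos.
have [f [A [_ _ fA mf]]] := step (Num.truncn (m (chi mH))^-1).+1.
have : m f <= m (chi measurableT).
  apply: (mean_le hm); apply: nearW => y.
  rewrite fA -[chi measurableT y]/(\1_setT y) !indicE in_setT lern1; exact: leq_b1.
apply/negP; rewrite (mean_one hm) -ltNge mf -ltr_pdivrMr// div1r; exact: truncnS_gt.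
Qed.

End null_subgroups.

(** * Flows over right cosets *)

Section cosets.
Context (R : realType) (G : lcGroupType) (mu : haar_measure R G).
Local Notation ess := (ess_haar mu).
Context (H : set G) (sgH : open_subgroup H).

(** Right cosets [H y], since left translation by elements of [H] preserves each of them. *)
Definition right_coset (y : G) : set G := [set z | H (z * y^-1)%g].

Lemma right_coset_refl y : right_coset y y.
Proof. by case: sgH => _ H1 _ _; rewrite /right_coset/= mulgV. Qed.

Lemma right_coset_eq y z : right_coset y z -> right_coset z = right_coset y.
Proof.
case: sgH => _ _ HM HV Hzy; apply/seteqP; split => t /= Ht.
  by have := HM _ _ Ht Hzy; rewrite mulgA mulgVK.
by have := HM _ _ Ht (HV _ Hzy); rewrite invgM invgK mulgA mulgVK.
Qed.

Lemma right_coset_mull h y z : H h -> right_coset y z -> right_coset y (h * z)%g.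
Proof. by case: sgH => _ _ HM HV Hh Hz; rewrite /right_coset/= -mulgA; exact: HM. Qed.

Lemma right_coset_sub y z : H y -> right_coset y z -> H z.
Proof. by case: sgH => _ _ HM _ Hy Hz; have := HM _ _ Hz Hy; rewrite mulgVK. Qed.

Lemma open_right_coset y : open (right_coset y).
Proof. by case: sgH => oH _ _ _; apply: open_comp => // z _; exact: mulgr_cts. Qed.

Lemma right_coset_trans y : right_coset y = [set (z * y)%g | z in H].
Proof.
apply/seteqP; split => z; first by move=> Hz; exists (z * y^-1)%g => //; rewrite mulgVK.
by move=> [h Hh <-]; rewrite /right_coset/= mulgK.
Qed.

Lemma compact_right_cosets K : compact K ->
  exists s : seq G, K `<=` \big[setU/set0]_(y <- s) right_coset y.
Proof.
rewrite compact_cover => /(_ G setT right_coset) [|z _|D _ KD].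
- by move=> y _; exact: open_right_coset.
- by exists z => //; exact: right_coset_refl.
- by exists (finmap.enum_fset D) => z /KD; rewrite -bigcup_fset.
Qed.

Lemma coset_measurable (A : set (hmeas mu)) :
  (forall y, measurable (A `&` right_coset y : set (hmeas mu))) -> measurable A.
Proof.
move=> mA; apply: locally_hmeas => K cK.
have [s Ks] := compact_right_cosets cK.
rewrite (_ : A `&` K = (\big[setU/set0]_(y <- s) (A `&` right_coset y)) `&` K).
  apply: measurableI; last exact: compact_hmeas.
  by apply: bigsetU_measurable.
rewrite -big_distrr/= -setIA; congr (_ `&` _).
by apply/esym/setIidr.
Qed.

Lemma coset_null (A : set (hmeas mu)) : measurable A ->
  (forall y, ess (A `&` right_coset y) = 0%E) -> ess A = 0%E.
Proof.
move=> mA A0; apply/eqP; rewrite eq_le ess_haar_ge0 andbT.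
apply: ge_ereal_sup => _ [K cK <-].
have [s Ks] := compact_right_cosets cK.
rewrite -(ess_sub_compact mu cK); last exact: subIsetr.
apply: (@le_trans _ _ (ess (A `&` \big[setU/set0]_(y <- s) right_coset y))).
  by apply: ess_haar_le; apply: setIS.
elim: s {Ks} => [|y s ih]; first by rewrite big_nil setI0 ess_haar0.
rewrite big_cons setIUr; apply: le_trans (measureU2 ess _ _) _.
- by apply: measurableI => //; apply: open_hmeas; exact: open_right_coset.
- apply: measurableI => //; apply: bigsetU_measurable => z _.
  by apply: open_hmeas; exact: open_right_coset.
by rewrite /= A0 add0e.
Qed.

End cosets.

Lemma half_gap_lt0 (R : realFieldType) (a b : R) : a < 0 -> `|a - b| <= - a / 2 -> b < 0.
Proof. by move=> a0; rewrite ler_norml => /andP[? _]; lra. Qed.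

Section haar_flow.
Context (R : realType) (G : lcGroupType) (mu : haar_measure R G).
Local Notation ess := (ess_haar mu).

Lemma measurable_mulgl (x : G) :
  measurable_fun setT ((fun y => x * y)%g : hmeas mu -> hmeas mu).
Proof.
move=> _ A mA; rewrite setTI.
by have := hmeasurable_ltrans x^-1%g mA; rewrite ltransE invgK.
Qed.

Lemma ess_mulgl (x : G) (A : set (hmeas mu)) : measurable A ->
  ess ((fun y => x * y)%g @^-1` A) = ess A.
Proof.
move=> mA; have -> : (fun y => x * y)%g @^-1` A = ltrans x^-1%g A by rewrite ltransE invgK.
apply/eqP; rewrite eq_le ess_haar_ltrans/=.
by rewrite -{1}[A](ltransK x) ess_haar_ltrans.
Qed.

Lemma Rintegral_translation_dist (x : G) (B : set G) : compact B ->
  \int[ess]_z `|\1_B (x^-1 * z)%g - \1_B z| = fine (mu (ltrans x B `+` B)).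
Proof.
move=> cB; have cxB := compact_ltrans (x := x) cB.
have mS : measurable (ltrans x B `+` B : set (borel G)).
  by apply: measurableU; apply: measurableD; exact: compact_borel.
have SK : ltrans x B `+` B `<=` ltrans x B `|` B.
  by move=> z [[? _]|[? _]]; [left|right].
rewrite -measurable_mu_extE// -(ess_sub_compact mu (compactU cxB cB) SK).
rewrite -Rintegral_indic; last first.
  by apply: measurableU; apply: measurableD; exact: compact_hmeas.
apply: eq_Rintegral => z _; rewrite !indicE ltransE.
have -> : (x^-1 * z)%g \in B = (z \in (fun y => x^-1 * y)%g @^-1` B) by apply/idP/idP; rewrite !inE.
rewrite /setY in_setU !in_setD.
by do 2 case: (_ \in _) => /=; rewrite ?(subrr, subr0, sub0r, normrN, normr0, normr1).
Qed.

Context (k : nat) (x : 'I_k -> G).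
Context (psi : G -> R) (C eps : R).
Hypotheses (mpsi : measurable_fun setT (psi : hmeas mu -> R))
  (psiC : forall y, `|psi y| <= C) (eps0 : 0 < eps).

Let f (i : 'I_k) (z : hmeas mu) : hmeas mu := (x i * z)%g.
Let g (i : 'I_k) (z : hmeas mu) : hmeas mu := ((x i)^-1 * z)%g.
Let fK i : cancel (f i) (g i). Proof. exact: mulKg. Qed.
Let mf i : measurable_fun setT (f i). Proof. exact: measurable_mulgl. Qed.
Let mg i : measurable_fun setT (g i). Proof. exact: measurable_mulgl. Qed.
Let minv i A : measurable A -> ess (f i @^-1` A) = ess A.
Proof. exact: ess_mulgl. Qed.
Let C0 : 0 <= C. Proof. exact: le_trans (psiC 1%g). Qed.
Let lam := C / eps.
Let lam0 : 0 <= lam. Proof. by rewrite divr_ge0// ltW. Qed.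

(** A compact set that is not a Folner set has [eps * |B| <= |x i B `+` B|] for
    some [i]; with the capacity [lam = C / eps] this boundary term pays for the
    worst value [- C * |B|] of the integral of [psi].  Sets of finite measure
    follow by approximation from inside. *)
Lemma folner_cut_cost (X : set G) :
  (forall B, B `<=` X -> folner_sets mu (range x) eps B ->
    0 <= \int[ess]_y (\1_B y * psi y)) ->
  forall A : set (hmeas mu), measurable A -> A `<=` X -> (ess A < +oo)%E ->
    0 <= cut_cost ess g psi lam \1_A.
Proof.
move=> hX.
have compact_cost B : compact B -> B `<=` X -> 0 <= cut_cost ess g psi lam \1_B.
  move=> cB BX; have mB := compact_hmeas mu cB.
  have Bfin : (ess B < +oo)%E by rewrite (ess_compact mu cB) haar_compact.
  have jB := integrableR_indic mB Bfin.
  have lb : - (C * fine (mu B)) <= \int[ess]_y (\1_B y * psi y).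
    rewrite lerNl; apply: le_trans (ler_norm _) _; rewrite normrN.
    apply: le_trans (Rintegral_norm (integrableRM jB mpsi psiC)) _.
    rewrite -(ess_compact mu cB) -Rintegral_indic// -RintegralZl//.
    apply: Rintegral_le; [exact/integrableR_norm/(integrableRM jB mpsi psiC)|exact: integrableRZ|].
    by move=> y; rewrite normrM mulrC [`|\1_B y|]ger0_norm// ler_wpM2r.
  have sum0 : 0 <= \sum_i \int[ess]_y `|\1_B (g i y) - \1_B y| :> R.
    by apply: sumr_ge0 => i _; apply: Rintegral_ge0.
  have [B0|Bpos] := leP (mu B) 0%E.
    have muB0 : mu B = 0%E by apply/eqP; rewrite eq_le B0 measure_ge0.
    rewrite muB0 /= mulr0 oppr0 in lb; apply: addr_ge0; [exact: lb|exact: mulr_ge0].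
  have Bpos' : 0 < fine (mu B) by rewrite fine_gt0// Bpos haar_compact.
  have [FB|nFB] := pselect (folner_sets mu (range x) eps B).
    by apply: addr_ge0; [exact: hX|exact: mulr_ge0].
  have [i Hi] : exists i, eps * fine (mu B) <= fine (mu (ltrans (x i) B `+` B)).
    apply: contrapT => /forallNP nE; apply: nFB; split => // _ [i _ <-].
    by rewrite ltr_pdivrMr// ltNge; apply/negP; exact: nE.
  rewrite /cut_cost -lerBlDl sub0r; apply: le_trans (_ : C * fine (mu B) <= _).
    by rewrite lerNl.
  rewrite (bigD1 i)//= mulrDr.
  apply: (@le_trans _ _ (lam * \int[ess]_y `|\1_B (g i y) - \1_B y|)); last first.
    by rewrite lerDl mulr_ge0// sumr_ge0// => j _; exact: Rintegral_ge0.
  rewrite Rintegral_translation_dist//; apply: le_trans (ler_wpM2l lam0 Hi).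
  by rewrite mulrA divfK// gt_eqF.
move=> A mA AX Afin; rewrite leNgt; apply/negP => neg.
pose K := C + lam * (2 * k%:R).
have K0 : 0 <= K by rewrite addr_ge0// mulr_ge0.
pose e := - cut_cost ess g psi lam \1_A / 2 / (K + 1).
have e0 : 0 < e by rewrite !divr_gt0 ?oppr_gt0 ?ltr_wpDl.
have [B [cB BA Be]] := ess_inner mA Afin e0.
have mB := compact_hmeas mu cB.
have jA := integrableR_indic mA Afin.
have Bfin : (ess B < +oo)%E by rewrite (ess_compact mu cB) haar_compact.
have jB := integrableR_indic mB Bfin.
have := compact_cost _ cB (subset_trans BA AX).
have := cut_cost_lipschitz fK mg minv mpsi psiC lam0 jA jB.
have dAB : \int[ess]_y `|\1_A y - \1_B y| <= e.
  have -> : \int[ess]_y `|\1_A y - \1_B y| = \int[ess]_y \1_(A `\` B) y.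
    apply: eq_Rintegral => y _; rewrite !indicE in_setD.
    case: (boolP (y \in B)) => [|_]; last first.
      by rewrite andbT subr0 ger0_norm.
    by rewrite inE => /BA Ay; rewrite mem_set//= subrr normr0.
  rewrite Rintegral_indic; last exact: measurableD.
  rewrite -lee_fin fineK// ge0_fin_numE ?ess_haar_ge0//; apply: le_lt_trans Be _; exact: ltry.
have le2 : K * \int[ess]_y `|\1_A y - \1_B y| <= - cut_cost ess g psi lam \1_A / 2.
  apply: le_trans (ler_wpM2l K0 dAB) _; rewrite /e mulrCA ler_piMr ?divr_ge0 ?oppr_ge0 ?(ltW neg)//.
  by rewrite ler_pdivrMr ?ltr_wpDl// mul1r lerDl.
move=> /le_trans/(_ le2) dist cB0.
by have := half_gap_lt0 neg dist; rewrite ltNge cB0.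
Qed.

Lemma haar_flow_exists (X : set G) : sigma_compact X ->
  (forall i y, X y -> X (x i * y)%g) ->
  (forall B, B `<=` X -> folner_sets mu (range x) eps B ->
    0 <= \int[ess]_y (\1_B y * psi y)) ->
  exists phi : 'I_k -> G -> R,
    (forall i, measurable_fun setT (phi i : hmeas mu -> R) /\ forall y, `|phi i y| <= lam) /\
    {ae ess, forall y, X y -> 0 <= psi y + \sum_i (phi i (x i * y)%g - phi i y)}.
Proof.
move=> [D [cD XD]] Xinv hX.
have [w [jw w01 wX]] := @sigma_finite_weight _ _ _ ess D (fun n => compact_hmeas mu (cD n))
  (fun n => eq_ind_r (fun z => (z < +oo)%E) (haar_compact mu (cD n)) (ess_compact mu (cD n))).
have wXE : [set y | 0 < w y] = X.
  by rewrite XD; apply/seteqP; split => y /wX.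
have cut : forall A : set (hmeas mu), measurable A -> A `<=` [set y | 0 < w y] ->
    (ess A < +oo)%E -> 0 <= cut_cost ess g psi lam \1_A.
  by rewrite wXE; exact: folner_cut_cost.
have winv i y : 0 < w y -> 0 < w (f i y).
  by move=> /wX; rewrite -XD => /(Xinv i); rewrite XD => /wX.
have [phi [aphi aephi]] := flow_exists fK mf mg minv mpsi psiC lam0 jw w01 cut winv.
exists phi; split => //; apply: filterS aephi => y Hy Xy.
by apply: Hy; apply/wX; rewrite -XD.
Qed.

End haar_flow.

(** * Folner sets on which a function does not exceed its mean *)

Section folner_below_mean.
Context (R : realType) (G : lcGroupType) (mu : haar_measure R G).
Local Notation ess := (ess_haar mu).
Local Notation Loo := (Linfty mu).

(** If there were no such set, the hypothesis of [haar_flow_exists] would hold for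
    [psi - (m psi + eta)] on every right coset of [H] other than [H] itself, and
    the glued flow would contradict the invariance of [m]. *)
Lemma exists_folner_below_mean (m : {scalar Loo}) (psi : Loo) (C eps eta : R)
    (k : nat) (x : 'I_k -> G) (S : set G) :
  kappa_gt_aleph0 [set: G] -> LIM mu m -> (forall y, `|psi y| <= C) ->
  0 < eps -> 0 < eta -> sigma_compact S ->
  exists B, [/\ folner_sets mu (range x) eps B, B `&` S = set0 &
    \int[ess]_y (\1_B y * psi y) <= (m psi + eta) * fine (mu B)].
Proof.
move=> hG hLIM psiC eps0 eta0 sS; apply: contrapT => neg.
have [hm minv] := hLIM.
have mpsi : measurable_fun setT (psi : hmeas mu -> R) by exact: measurable_funPT.
pose c := m psi + eta.
have [H [sgH sH SxH]] : exists H, [/\ open_subgroup H, sigma_compact H & S `|` range x `<=` H].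
  apply: sigma_compact_sub_open_subgroup; apply: sigma_compactU => //.
  by apply/compact_sigma_compact/finite_compact; exact: finite_image.
have SH : S `<=` H by move=> y Sy; apply: SxH; left.
have xH i : H (x i) by apply: SxH; right; exists i.
have mH : measurable (H : set (hmeas mu)) by apply: open_hmeas; case: sgH.
pose C1 := C + `|c|.
pose psi1 y := psi y - c.
have mpsi1 : measurable_fun setT (psi1 : hmeas mu -> R) by exact: measurable_funB.
have psi1C y : `|psi1 y| <= C1 by apply: le_trans (ler_normB _ _) _; rewrite lerD2r.
pose good X (phi : 'I_k -> G -> R) :=
  (forall i, measurable_fun setT (phi i : hmeas mu -> R) /\ forall y, `|phi i y| <= C1 / eps) /\
  {ae ess, forall y, X y -> 0 <= psi1 y + \sum_i (phi i (x i * y)%g - phi i y)}.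
(* One flow for each coset, chosen as a function of the coset as a set. *)
have /choice[pick pickP] : forall X : set G, exists phi,
    (exists2 y, ~ H y & X = right_coset H y) -> good X phi.
  move=> X; have [[y nHy XE]|nX] := pselect (exists2 y, ~ H y & X = right_coset H y); last first.
    by exists (fun _ _ => 0).
  have sX : sigma_compact X by rewrite XE right_coset_trans; exact: sigma_compact_rtrans.
  have [|B BX FB|phi phiP] := haar_flow_exists mpsi1 psi1C eps0 sX (x := x).
  - by move=> i z; rewrite XE; exact: right_coset_mull.
  - rewrite leNgt; apply/negP => Bneg; apply: neg; exists B; split => //.
      apply/seteqP; split => // z [/BX + Sz]; rewrite XE => Xz; apply: nHy.
      case: (sgH) => _ _ HM HV; have := HM _ _ (HV _ Xz) (SH _ Sz).
      by rewrite invgM invgK mulgVK.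
    have [cB muB _] := FB.
    have mB := compact_hmeas mu cB.
    have Bfin : (ess B < +oo)%E by rewrite (ess_compact mu cB) haar_compact.
    have jB := integrableR_indic mB Bfin.
    have jBpsi := integrableRM jB mpsi psiC.
    move: Bneg; under eq_Rintegral do rewrite mulrBr.
    rewrite RintegralB//; last by under eq_fun do rewrite mulrC; exact: integrableRZ.
    rewrite RintegralZr// (_ : \int[ess]_y \1_B y = fine (mu B)).
      by rewrite subr_lt0 mulrC; exact: ltW.
    by rewrite Rintegral_indic//; congr fine; exact: ess_compact.
  - by exists phi => _.
pose Phi i z := if z \in H then 0 else pick (right_coset H z) i z.
have PhiE i y z : ~ H y -> right_coset H y z -> Phi i z = pick (right_coset H y) i z.
  move=> nHy yz; rewrite /Phi memNset; first by rewrite (right_coset_eq sgH yz).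
  move=> Hz; apply: nHy; case: (sgH) => _ _ HM HV.
  by have := HM _ _ (HV _ yz) Hz; rewrite invgM invgK mulgVK.
have Phi0 i z : H z -> Phi i z = 0 by move=> Hz; rewrite /Phi mem_set.
have C1eps0 : 0 <= C1 / eps.
  by rewrite divr_ge0 ?(ltW eps0)//; exact: le_trans (psi1C 1%g).
have goodc y : ~ H y -> good (right_coset H y) (pick (right_coset H y)).
  by move=> nHy; apply: pickP; exists y.
have PhiC i z : `|Phi i z| <= C1 / eps.
  have [Hz|nHz] := pselect (H z); first by rewrite Phi0// normr0.
  rewrite (PhiE _ _ _ nHz (right_coset_refl sgH z)).
  by have [/(_ i)[_ ]] := goodc z nHz.
have mPhi i : measurable_fun setT (Phi i : hmeas mu -> R).
  move=> _ Y mY; rewrite setTI; apply: (coset_measurable sgH) => y.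
  have mX : measurable (right_coset H y : set (hmeas mu)) by exact/open_hmeas/open_right_coset.
  have [Hy|nHy] := pselect (H y).
    have [Y0|nY0] := pselect (Y 0).
      rewrite (_ : _ `&` _ = right_coset H y)//; apply/setIidr => z yz.
      by rewrite /= Phi0//; exact: right_coset_sub yz.
    rewrite (_ : _ `&` _ = set0)//; apply/seteqP; split => // z [/= + yz].
    by rewrite Phi0//; exact: right_coset_sub yz.
  rewrite (_ : _ `&` _ = (pick (right_coset H y) i @^-1` Y) `&` right_coset H y).
    apply: measurableI => //; rewrite -[X in measurable X]setTI.
    by have [/(_ i)[mp _] _] := goodc y nHy; exact: mp.
  by apply/seteqP; split => z [/= + yz]; rewrite (PhiE _ _ _ nHy yz).
pose F i : Loo := bounded_fun_Linfty (mPhi i) (PhiC i).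
(* The last term makes [g] nonnegative on [H], where the flow is zero. *)
pose g : Loo := psi - c *: chi measurableT + \sum_i (ltransl (x i)^-1%g (F i) - F i) + C1 *: chi mH.
have gE y : g y = psi1 y + \sum_i (Phi i (x i * y)%g - Phi i y) + C1 * \1_H y.
  rewrite -[g y]/(psi y - c * \1_setT y +
    (\sum_i (ltransl (x i)^-1%g (F i) - F i)) y + C1 * \1_H y).
  rewrite Linfty_sumE indicE in_setT mulr1; congr (_ + _ + _); apply: eq_bigr => i _.
  by rewrite -[LHS]/(Phi i ((x i)^-1^-1 * y)%g - Phi i y) invgK.
have mg : m g = - eta.
  have -> : m g = m psi - c * m (chi measurableT) +
      \sum_i (m (ltransl (x i)^-1%g (F i)) - m (F i)) + C1 * m (chi mH).
    rewrite !linearD linearN !linearZ/= linear_sum; congr (_ + _ + _).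
    by apply: eq_bigr => i _; rewrite linearB.
  rewrite (mean_one hm) (LIM_sigma_compact_open_subgroup mH hG hLIM sgH sH) mulr0 addr0.
  by rewrite big1 ?addr0 ?mulr1 /c => [|i _]; [ring|rewrite -minv subrr].
have mbad : measurable ([set y | g y < 0] : set (hmeas mu)).
  rewrite (_ : [set y | g y < 0] = g @^-1` `]-oo, 0[%classic).
    rewrite -[X in measurable X]setTI.
    have mg' : measurable_fun setT (g : hmeas mu -> R) by exact: measurable_funPT.
    exact: mg'.
  by apply/seteqP; split => y /=; rewrite in_itv.
have bad0 : ess [set y | g y < 0] = 0%E.
  apply: (coset_null sgH mbad) => y; have [Hy|nHy] := pselect (H y).
    rewrite (_ : _ `&` _ = set0) ?ess_haar0//; apply/seteqP; split => // z [gz yz].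
    have {gz} : g z < 0 := gz.
    have Hz : H z := right_coset_sub sgH Hy yz.
    case: (sgH) => _ _ HM _.
    rewrite gE indicE mem_set// mulr1 big1 => [|i _].
      by have := psi1C z; rewrite ler_norml => /andP[? _]; lra.
    by rewrite !Phi0 ?subrr//; exact: HM.
  have [_ [N [mN N0 subN]]] := goodc y nHy.
  apply/eqP; rewrite eq_le ess_haar_ge0 andbT -N0; apply: ess_haar_le => z [gz yz].
  have {gz} : g z < 0 := gz; rewrite gE => gneg; apply: subN => /= /(_ yz).
  rewrite leNgt => /negP; apply; apply: le_lt_trans gneg.
  rewrite (eq_bigr (fun i => Phi i (x i * z)%g - Phi i z)) => [|i _].
    by rewrite lerDl mulr_ge0// (le_trans _ (psi1C z)).
  by rewrite !(PhiE _ _ _ nHy)//; exact: right_coset_mull.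
have : 0 <= m g.
  apply: (mean_ge0 hm); exists [set y | g y < 0]; split => //.
  by move=> y /= /negP; rewrite -ltNge.
by rewrite mg oppr_ge0 leNgt eta0.
Qed.

End folner_below_mean.

(** * Balancing Folner sets *)

Lemma Rintegral_ae_le d (T : measurableType d) (R : realType) (m : {measure set T -> \bar R})
    (f h : T -> R) : integrableR m f -> integrableR m h ->
  {ae m, forall y, f y <= h y} -> \int[m]_y f y <= \int[m]_y h y.
Proof.
move=> jf jh fh; rewrite -subr_ge0 -RintegralB//.
have jd := integrableRB jh jf.
suff -> : \int[m]_y (h y - f y) = \int[m]_y `|h y - f y| by exact: Rintegral_ge0.
congr fine; apply: ae_eq_integral => //.
- exact: measurable_int jd.
- exact: measurable_int (integrableR_norm jd).
- by apply: filterS fh => y Hy _; rewrite ger0_norm// subr_ge0.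
Qed.

Section uniform_means.
Context (R : realType) (G : lcGroupType) (mu : haar_measure R G).
Local Notation ess := (ess_haar mu).
Local Notation Loo := (Linfty mu).

Lemma means_unif (A : set G) (cA : compact A) : (0 < mu A)%E ->
  means mu (L1_dual (unif mu cA)).
Proof.
move=> Apos; have mA := compact_hmeas mu cA.
have Afin : (ess A < +oo)%E by rewrite (ess_compact mu cA) haar_compact.
have jA := integrableR_indic mA Afin.
have v0 : 0 < fine (mu A) by rewrite fine_gt0// Apos haar_compact.
pose u y : R := \1_A y / fine (mu A).
have ju : integrableR ess u.
  by rewrite /u; under eq_fun do rewrite mulrC; exact: integrableRZ.
have u0 y : 0 <= u y by rewrite divr_ge0// ltW.
have u1 : \int[ess]_y u y = 1.
  rewrite /u RintegralZr// (_ : \int[ess]_y \1_A y = fine (mu A)) ?divff ?gt_eqF//.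
  by rewrite Rintegral_indic//; congr fine; exact: ess_compact.
have jphi (phi : Loo) : integrableR ess (fun y => u y * phi y).
  exact: (integrable_L1_Linfty (unif mu cA) phi).
have E phi : L1_dual (unif mu cA) phi = \int[ess]_y (u y * phi y) by [].
split.
- apply/eqP; rewrite eq_le; apply/andP; split.
    apply: ge_ereal_sup => _ [phi /norm_le1_ae phi1 <-]; rewrite lee_fin E -[leRHS]u1.
    apply: le_trans (Rintegral_norm (jphi phi)) _.
    apply: Rintegral_ae_le => //; first exact: integrableR_norm.
    apply: filterS phi1 => y phi1; rewrite normrM ger0_norm// -[leRHS]mulr1.
    exact: ler_wpM2l.
  apply: ereal_sup_ubound; exists (chi (mu := mu) measurableT); first exact: chiT_norm_le1.
  rewrite E (_ : \int[ess]_y _ = 1) ?normr1// -[RHS]u1; apply: eq_Rintegral => y _.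
  by rewrite -[chi _ y]/(\1_setT y) indicE in_setT mulr1.
- move=> phi phi0; rewrite E.
  rewrite [leLHS](_ : 0 = \int[ess]_y (0 : R)); last by rewrite Rintegral_cst// mul0r.
  apply: Rintegral_ae_le => //; first exact: integrableR0.
  by apply: filterS phi0 => y; exact: mulr_ge0.
Qed.

End uniform_means.

Section assembling.
Context (R : realType) (G : lcGroupType) (mu : haar_measure R G).
Local Notation ess := (ess_haar mu).
Local Notation Loo := (Linfty mu).
Local Notation vol B := (fine (mu B)).

Lemma folner_setU (K : set G) (eps : R) (A B : set G) : A `&` B = set0 ->
  folner_sets mu K eps A -> folner_sets mu K eps B ->
  folner_sets mu K eps (A `|` B) /\ vol (A `|` B) = vol A + vol B.
Proof.
move=> AB [cA A0 KA] [cB B0 KB].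
have mA := compact_borel cA; have mB := compact_borel cB.
have fA := haar_compact mu cA; have fB := haar_compact mu cB.
have finA : mu A \is a fin_num by rewrite ge0_fin_numE.
have finB : mu B \is a fin_num by rewrite ge0_fin_numE.
have volU : mu (A `|` B) = (mu A + mu B)%E by rewrite measureU.
have volU' : vol (A `|` B) = vol A + vol B by rewrite volU fineD.
have vA : 0 < vol A by rewrite fine_gt0// A0.
have vB : 0 < vol B by rewrite fine_gt0// B0.
split => //; split; first exact: compactU.
  by rewrite volU adde_gt0.
move=> x Kx; rewrite volU' ltr_pdivrMr ?addr_gt0//.
have mD C : compact C -> measurable (ltrans x C `+` C : set (borel G)).
  move=> cC; have cxC := compact_ltrans (x := x) cC.
  by apply: measurableU; apply: measurableD; exact: compact_borel.
have fD C : compact C -> mu (ltrans x C `+` C) \is a fin_num.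
  move=> cC; have cxC := compact_ltrans (x := x) cC.
  rewrite ge0_fin_numE//; apply: le_lt_trans (haar_compact mu (compactU cxC cC)).
  apply: le_measure; rewrite ?inE; [exact: mD|exact: compact_borel (compactU _ _)|].
  by move=> z [[? _]|[? _]]; [left|right].
have sub : ltrans x (A `|` B) `+` (A `|` B) `<=` (ltrans x A `+` A) `|` (ltrans x B `+` B).
  rewrite !ltransE => z [[/= [Az|Bz] nAB]|[[Az|Bz] /= nAB]].
  - by left; left; split => // Az'; apply: nAB; left.
  - by right; left; split => // Bz'; apply: nAB; right.
  - by left; right; split => // Az'; apply: nAB; left.
  - by right; right; split => // Bz'; apply: nAB; right.
apply: (@le_lt_trans _ _ (vol (ltrans x A `+` A) + vol (ltrans x B `+` B))).
  rewrite -fineD ?fD//; apply: fine_le; [exact/fD/compactU|by rewrite fin_numD !fD|].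
  apply: le_trans (measureU2 _ (mD _ cA) (mD _ cB)).
  apply: le_measure; rewrite ?inE => //; first by apply: mD; exact: compactU.
  by apply: measurableU; exact: mD.
by rewrite mulrDr ltrD// -ltr_pdivrMr// ?KA ?KB.
Qed.

Context (m : {scalar Loo}) (hLIM : LIM mu m) (hG : kappa_gt_aleph0 [set: G]).
Context (n : nat) (E : 'I_n -> set (hmeas mu)) (mE : forall i, measurable (E i)).

Let p i : R := m (chi (mE i)).

(** The signed measure [|B `&` E i| - p i * |B|], as an integral so that it is
    visibly linear. *)
Definition discrepancy i (B : set G) : R :=
  \int[ess]_y (\1_B y * (\1_(E i) y - p i)).

Let hm : means mu m. Proof. by case: hLIM. Qed.

Lemma mean_chi01 i : 0 <= p i <= 1.
Proof.
apply/andP; split; first by apply: (mean_ge0 hm); apply: nearW => y.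
have : m (chi (mE i)) <= m (chi measurableT).
  apply: (mean_le hm); apply: nearW => y.
  rewrite -[chi measurableT y]/(\1_setT y) -[chi (mE i) y]/(\1_(E i) y).
  by rewrite !indicE in_setT lern1 leq_b1.
by rewrite (mean_one hm).
Qed.

Let compact_facts B : compact B -> [/\ integrableR ess (\1_B : hmeas mu -> R),
  \int[ess]_y \1_B y = vol B &
  forall i, integrableR ess (fun y => \1_B y * (\1_(E i) y - p i) : R)].
Proof.
move=> cB; have mB := compact_hmeas mu cB.
have Bfin : (ess B < +oo)%E by rewrite (ess_compact mu cB) haar_compact.
have jB := integrableR_indic mB Bfin; split => //.
  by rewrite Rintegral_indic//; congr fine; exact: ess_compact.
move=> i; apply: (integrableRM (M := 1) jB) => [|y].
  by apply: measurable_funB => //; exact: measurable_indic.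
have /andP[? ?] := mean_chi01 i.
by rewrite indicE ler_norml; case: (_ \in _) => /=; lra.
Qed.

Lemma discrepancy_le i B : compact B -> `|discrepancy i B| <= vol B.
Proof.
move=> cB; have [jB vB jBE] := compact_facts cB.
apply: le_trans (Rintegral_norm (jBE i)) _; rewrite -vB.
apply: Rintegral_le => //; first exact: integrableR_norm.
move=> y; rewrite normrM ger0_norm// ler_piMr//.
have /andP[? ?] := mean_chi01 i.
by rewrite [\1_(E i) y]indicE ler_norml; case: (_ \in _) => /=; lra.
Qed.

Lemma discrepancyU i A B : compact A -> compact B -> A `&` B = set0 ->
  discrepancy i (A `|` B) = discrepancy i A + discrepancy i B.
Proof.
move=> cA cB AB; have [_ _ jA] := compact_facts cA; have [_ _ jB] := compact_facts cB.
rewrite /discrepancy -RintegralD//; apply: eq_Rintegral => y _.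
rewrite -mulrDl; congr (_ * _); rewrite !indicE in_setU.
case: (boolP (y \in A)) => [|_]; last by rewrite add0r.
rewrite inE => Ay; rewrite (memNset (A := B)) ?addr0// => By.
by have : (A `&` B) y by []; rewrite AB.
Qed.

Context (k : nat) (x : 'I_k -> G) (eps : R) (eps0 : 0 < eps).
Local Notation folner := (folner_sets mu (range x) eps).

Lemma folner_volume_gt0 B : folner B -> 0 < vol B.
Proof. by move=> [cB B0 _]; rewrite fine_gt0// B0 haar_compact. Qed.

(** [exists_folner_below_mean] for the combination [\sum_i a i *: chi (mE i)]. *)
Lemma exists_folner_opposing (a : 'I_n -> R) (S : set G) (eta : R) :
  sigma_compact S -> 0 < eta ->
  exists B, [/\ folner B, B `&` S = set0 & \sum_i a i * discrepancy i B <= eta * vol B].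
Proof.
move=> sS eta0.
pose psi : Loo := \sum_i a i *: chi (mE i).
have psiE y : psi y = \sum_i a i * \1_(E i) y by rewrite /psi Linfty_sumE.
have psiC y : `|psi y| <= \sum_i `|a i|.
  rewrite psiE; apply: le_trans (ler_norm_sum _ _ _) _; apply: ler_sum => i _.
  by rewrite normrM ler_piMr// ger0_norm// indicE lern1 leq_b1.
have [B [FB BS IB]] := exists_folner_below_mean x hG hLIM psiC eps0 eta0 sS.
exists B; split => //; have [cB _ _] := FB; have [jB vB jBE] := compact_facts cB.
have mpsi : m psi = \sum_i a i * p i.
  by rewrite /psi linear_sum; apply: eq_bigr => i _; rewrite linearZ.
have jBpsi : integrableR ess (fun y => \1_B y * psi y).
  by apply: integrableRM psiC => //; exact: measurable_funPT.
rewrite -(lerD2l (m psi * vol B)) -mulrDl; apply: le_trans IB.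
rewrite le_eqVlt; apply/orP; left; apply/eqP; rewrite mpsi -vB -RintegralZl//.
under [X in _ + X]eq_bigr => i _ do rewrite /discrepancy -RintegralZl//.
rewrite -Rintegral_sum => [|i]; last exact: integrableRZ.
rewrite -RintegralD//; [|exact: integrableRZ|by apply: integrableR_sum => i; exact: integrableRZ].
apply: eq_Rintegral => y _; rewrite psiE mulr_suml mulr_sumr -big_split/=.
by apply: eq_bigr => i _; ring.
Qed.

(** If no [M] works, each [N] has a direction [a_N] in the cube and a compact set
    [S_N] that defeat the bound [N.+1].  Take a cluster point [a] of the [a_N]
    and a Folner set [B] that opposes [a] outside the union of the [S_N]: it
    has some volume, hence respects the bound [N.+1] for all large [N], and it
    still opposes those [a_N] that are close to [a]. *)
Lemma exists_uniform_volume (eta : R) : 0 < eta ->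
  exists2 M : R, 0 < M & forall (a : 'I_n -> R) (S : set G), (forall i, `|a i| <= 1) -> compact S ->
    exists B, [/\ folner B, B `&` S = set0, M^-1 <= vol B <= M &
      \sum_i a i * discrepancy i B <= eta * vol B].
Proof.
move=> eta0; apply: contrapT => noM.
have bad (N : nat) : exists aS : 'rV[R]_n * set G, [/\ forall i, `|aS.1 ord0 i| <= 1, compact aS.2 &
    forall B, folner B -> B `&` aS.2 = set0 -> N.+1%:R^-1 <= vol B <= N.+1%:R ->
      eta * vol B < \sum_i aS.1 ord0 i * discrepancy i B].
  apply: contrapT => nbad; apply: noM; exists N.+1%:R => // a S a1 cS.
  apply: contrapT => nB; apply: nbad; exists (\row_i a i, S); split => //=.
    by move=> i; rewrite mxE.
  move=> B FB BS BN; rewrite ltNge; apply/negP => leB; apply: nB; exists B; split => //.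
  by apply: le_trans leB; apply: ler_sum => i _; rewrite mxE.
have /choice[aS HaS] := bad.
have cS : sigma_compact (\bigcup_N (aS N).2).
  by apply: sigma_compact_bigcup => N; apply: compact_sigma_compact; case: (HaS N).
pose cube : set 'rV[R]_n := [set v | forall i, `[-1, 1]%classic (v ord0 i)].
have ccube : compact cube.
  by apply: (@rV_compact R n (fun=> `[-1, 1]%classic)) => i; exact: segment_compact.
have Fcube : ((fun N => (aS N).1) @ \oo) cube.
  exists 0%N => // N _ i /=; case: (HaS N) => /(_ i) + _ _.
  by rewrite in_itv/= ler_norml.
have [a [acube acl]] := ccube _ _ Fcube.
have eta20 : 0 < eta / 2 by rewrite divr_gt0.
have [B [FB BS IB]] := exists_folner_opposing (fun i => a ord0 i) cS eta20.
have vB := folner_volume_gt0 FB; have [cB _ _] := FB.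
pose N0 := maxn (Num.truncn (vol B)) (Num.truncn (vol B)^-1).
have NB N : (N0 <= N)%N -> N.+1%:R^-1 <= vol B <= N.+1%:R.
  rewrite geq_max => /andP[l1 l2]; apply/andP; split.
    rewrite invf_ple ?posrE//; apply: le_trans (ltW (truncnS_gt _)) _.
    by rewrite ler_nat ltnS.
  by apply: le_trans (ltW (truncnS_gt _)) _; rewrite ler_nat ltnS.
pose dlt := eta / 2 / n.+1%:R.
have dlt0 : 0 < dlt by rewrite divr_gt0.
have tail : ((fun N => (aS N).1) @ \oo) [set v | exists2 N, (N0 <= N)%N & v = (aS N).1].
  by exists N0 => // N /= N0N; exists N.
have [_ [[N N0N ->] /= aN]] := acl _ _ tail (nbhsx_ballx a dlt dlt0).
have aNi i : `|a ord0 i - (aS N).1 ord0 i| < dlt.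
  by case: aN => _ /(_ ord0 i).
have BSN : B `&` (aS N).2 = set0.
  by apply/seteqP; split => // y [By Sy]; rewrite -BS; split => //; exists N.
have [_ _ /(_ B FB BSN (NB N N0N))] := HaS N; apply/negP; rewrite -leNgt.
have -> : \sum_i (aS N).1 ord0 i * discrepancy i B = \sum_i a ord0 i * discrepancy i B -
    \sum_i (a ord0 i - (aS N).1 ord0 i) * discrepancy i B.
  by rewrite -sumrB; apply: eq_bigr => i _; ring.
have -> : eta * vol B = eta / 2 * vol B + eta / 2 * vol B by field.
apply: lerD => //; apply: le_trans (ler_norm _) _; rewrite normrN.
apply: le_trans (ler_norm_sum _ _ _) _.
apply: (@le_trans _ _ (\sum_(i < n) dlt * vol B)).
  apply: ler_sum => i _; rewrite normrM; apply: ler_pM => //; first exact/ltW.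
  exact: discrepancy_le.
rewrite sumr_const card_ord -mulrnAl ler_wpM2r ?(ltW vB)//.
rewrite -mulr_natr /dlt -mulrA ler_piMr ?(ltW eta20)// mulrC ler_pdivrMr// mul1r ler_nat.
exact: leqnSn.
Qed.

(** Greedy balancing, as in Blackwell approachability.  A new set [B] is chosen to
    oppose the discrepancy vector [D(A)] of the union [A] of the previous ones,
    so that [|D(A `|` B)|^2 <= |D(A)|^2 + eta |A| |B| + |D(B)|^2]; therefore
    [|D(A)|^2 - (eta / 2) |A|^2] grows at most linearly in [|A|]. *)
Lemma exists_balanced_folner (eta : R) : 0 < eta ->
  exists2 A, folner A & \sum_i discrepancy i A ^+ 2 <= eta * vol A ^+ 2.
Proof.
move=> eta0; have eta20 : 0 < eta / 2 by rewrite divr_gt0.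
have [M M0 HM] := exists_uniform_volume eta20.
have sq B : compact B -> \sum_i discrepancy i B ^+ 2 <= n%:R * vol B ^+ 2.
  move=> cB; rewrite -[n in n%:R]card_ord mulrC mulr_natr -sumr_const ler_sum// => i _.
  have vB0 : 0 <= vol B by rewrite fine_ge0.
  rewrite -[X in X ^+ 2 <= _]/(discrepancy i B) -real_normK ?num_real// lerXn2r ?nnegrE//.
  exact: discrepancy_le.
have sqM B : compact B -> 0 <= vol B <= M -> \sum_i discrepancy i B ^+ 2 <= n%:R * M * vol B.
  move=> cB /andP[vB0 vBM]; apply: le_trans (sq B cB) _.
  by rewrite -mulrA ler_wpM2l// expr2 ler_wpM2r.
have step (N : nat) : exists A, [/\ folner A, N.+1%:R / M <= vol A &
    \sum_i discrepancy i A ^+ 2 <= eta / 2 * vol A ^+ 2 + n%:R * M * vol A].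
  elim: N => [|N [A [FA volA QA]]].
    have [|B [FB _ /andP[MB BM] _]] := HM (fun=> 0) set0 _ compact0; first by rewrite normr0.
    have vB := folner_volume_gt0 FB; have [cB _ _] := FB.
    exists B; split; [exact: FB|by rewrite mul1r|].
    apply: le_trans (sqM B cB _) _; first by rewrite (ltW vB).
    by rewrite lerDr mulr_ge0 ?(ltW eta20)// sqr_ge0.
  have vA := folner_volume_gt0 FA; have [cA _ _] := FA.
  have [i|B [FB BA /andP[MB BM] dirB]] := HM (fun i => discrepancy i A / vol A) A _ cA.
    by rewrite normrM normfV (gtr0_norm vA) ler_pdivrMr// mul1r discrepancy_le.
  have vB := folner_volume_gt0 FB; have [cB _ _] := FB.
  have AB : A `&` B = set0 by rewrite setIC.
  have [FAB vAB] := folner_setU AB FA FB.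
  exists (A `|` B); split; first exact: FAB.
    by rewrite vAB -natr1 mulrDl lerD// mul1r.
  have QB : \sum_i discrepancy i B ^+ 2 <= n%:R * M * vol B.
    by apply: sqM => //; rewrite (ltW vB).
  have cross : \sum_i discrepancy i A * discrepancy i B <= eta / 2 * vol B * vol A.
    rewrite -ler_pdivrMr//; apply: le_trans dirB.
    by rewrite mulr_suml; apply: ler_sum => i _; rewrite mulrAC.
  have -> : \sum_i discrepancy i (A `|` B) ^+ 2 = \sum_i discrepancy i A ^+ 2 +
      2 * (\sum_i discrepancy i A * discrepancy i B) + \sum_i discrepancy i B ^+ 2.
    rewrite mulr_sumr -!big_split/=; apply: eq_bigr => i _.
    by rewrite discrepancyU//; ring.
  have eB : 0 <= eta / 2 * vol B ^+ 2 by rewrite mulr_ge0 ?(ltW eta20)// sqr_ge0.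
  rewrite vAB.
  have -> : eta / 2 * (vol A + vol B) ^+ 2 + n%:R * M * (vol A + vol B) =
    (eta / 2 * vol A ^+ 2 + n%:R * M * vol A) + 2 * (eta / 2 * vol B * vol A) +
    (n%:R * M * vol B + eta / 2 * vol B ^+ 2) by ring.
  apply: lerD; last by apply: le_trans QB _; rewrite lerDl.
  by apply: lerD => //; rewrite ler_pM2l.
have [A [FA volA QA]] := step (Num.truncn (n%:R * M / (eta / 2) * M)).
exists A => //; apply: le_trans QA _; have vA := folner_volume_gt0 FA.
have big : n%:R * M <= eta / 2 * vol A.
  rewrite [leRHS]mulrC -ler_pdivrMr//; apply: (le_trans _ volA).
  by rewrite ler_pdivlMr// ltW// truncnS_gt.
have -> : eta * vol A ^+ 2 = eta / 2 * vol A ^+ 2 + (eta / 2 * vol A) * vol A by field.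
by rewrite lerD2l ler_wpM2r// ltW.
Qed.

Lemma exists_approximating_folner : exists A (cA : compact A), folner A /\
  forall i, `|p i - L1_dual (unif mu cA) (chi (mE i))| < eps.
Proof.
have eta0 : 0 < eps ^+ 2 / 2 by rewrite divr_gt0// exprn_gt0.
have [A FA QA] := exists_balanced_folner eta0.
have [cA _ _] := FA; have vA := folner_volume_gt0 FA.
have [jA volA jAE] := compact_facts cA.
exists A, cA; split => // i.
have -> : p i - L1_dual (unif mu cA) (chi (mE i)) = - (discrepancy i A / vol A).
  rewrite -[L1_dual _ _]/(\int[ess]_y (\1_A y / vol A * \1_(E i) y)).
  rewrite /discrepancy -RintegralZr//.
  have pE : \int[ess]_y (p i / vol A * \1_A y) = p i by rewrite RintegralZl// volA divfK ?gt_eqF.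
  have jAEi : integrableR ess (fun y => \1_A y / vol A * \1_(E i) y : R).
    exact: (integrable_L1_Linfty (unif mu cA) (chi (mE i))).
  rewrite -[X in X - _]pE -RintegralB//; last exact: integrableRZ.
  have jD : integrableR ess (fun y => \1_A y * (\1_(E i) y - p i) / vol A : R).
    by apply: eq_integrable (integrableRZ (vol A)^-1 (jAE i)) => // y _ /=; rewrite mulrC.
  rewrite -mulN1r -RintegralZl//.
  apply: eq_Rintegral => y _.
  by move: (\1_A y) (\1_(E i) y) (p i) (vol A)^-1 => a b c d; ring.
rewrite normrN normrM normfV (gtr0_norm vA) ltr_pdivrMr//.
rewrite -(@ltr_pXn2r _ 2)// ?nnegrE ?mulr_ge0 ?(ltW vA) ?(ltW eps0)//.
rewrite real_normK ?num_real//; apply: (@le_lt_trans _ _ (\sum_i discrepancy i A ^+ 2)).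
  by rewrite (bigD1 i)//= lerDl sumr_ge0// => j _; exact: sqr_ge0.
apply: le_lt_trans QA _; rewrite exprMn ltr_pM2r ?exprn_gt0//.
by rewrite ltr_pdivrMr// ltr_pMr ?exprn_gt0// ltr1n.
Qed.

End assembling.

Lemma finite_set_ordinal_range (T : eqType) (A : set T) : finite_set A ->
  exists k (x : 'I_k -> T), A = range x.
Proof.
move=> /finite_seqP[s ->]; exists (size s), (tnth (in_tuple s)).
apply/seteqP; split => y /=.
  by move=> /(tnthP (in_tuple s))[i ->]; exists i.
by move=> [i _ <-]; exact: (mem_tnth i (in_tuple s)).
Qed.

Theorem theorem7p2 (R : realType) (G : lcGroupType) (mu : haar_measure R G)
  (hG : kappa_gt_aleph0 [set: G]) : LIM0 mu = LIM mu.
Proof.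
apply/seteqP; split => [m []//|m hLIM]; split => // P K eps [finP _ mP] finK /andP[eps0 _].
have [n [E PE]] := finite_set_ordinal_range finP.
have [k [x KE]] := finite_set_ordinal_range finK.
have mE i : measurable (E i) by apply: mP; rewrite PE; exists i.
have [A [cA [FA close]]] := exists_approximating_folner hLIM hG mE x eps0.
exists A, cA; rewrite KE; split => //; split.
  by apply: means_unif; case: FA.
move=> F mF; rewrite PE => -[i _ EF]; move: mF; rewrite -EF => mEi.
by rewrite (Prop_irrelevance mEi (mE i)); exact: close.
Qed.
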